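(* Let $A\in\overline{\mathbb{R}}^{n\times n}$ and $\mathbf{x}\in\mathscr{X}$. Checking whether $\mathbf{x}$ is an extremal in $\mathscr{X}'$ by the algorithm described in the context (which returns true if $\mathbf{x}$ is an extremal in $\mathscr{X}'$ and false otherwise) requires no more than $O(n^2)$ operations.
   Context: Max-plus algebra: $\overline{\mathbb{R}}=\mathbb{R}\cup\{-\infty\}$ with $a\oplus b=\max(a,b)$ and $a\otimes b=a+b$ (where $a+(-\infty)=-\infty$), extended to matrices and vectors as in linear algebra, so $(A\otimes\mathbf{x})_i=\max_{j}(a_{ij}+x_j)$ and $\mathbf{x}\oplus\mathbf{y}$ is the componentwise maximum; $\le$ is componentwise. $N=\{1,\dots,n\}$; $-\infty$ also denotes the vector all of whose components are $-\infty$. For $A\in\overline{\mathbb{R}}^{n\times n}$ put $\mathscr{X}=\{\mathbf{x}\in\overline{\mathbb{R}}^n: A\otimes\mathbf{x}\ge\mathbf{x},\ \mathbf{x}\ne-\infty\}$ and $\mathscr{X}'=\mathscr{X}\cup\{-\infty\}$. $\mathrm{Supp}(\mathbf{x})=\{j\in N: x_j\in\mathbb{R}\}$. A vector $\mathbf{v}\in S\subseteq\overline{\mathbb{R}}^n$ is an extremal in $S$ if for all $\mathbf{y},\mathbf{z}\in S$, $\mathbf{v}=\mathbf{y}\oplus\mathbf{z}$ implies $\mathbf{v}=\mathbf{y}$ or $\mathbf{v}=\mathbf{z}$. Operations are elementary ones: arithmetic operations and comparisons on elements of $\overline{\mathbb{R}}$, and elementary steps on digraphs such as inspecting a node or an arc,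 each at unit cost. Tangent digraph: for $\mathbf{x}\in\mathscr{X}$ and $i\in\mathrm{Supp}(\mathbf{x})$ let $V_{\mathbf{x}}(i)=\{j\in N: a_{ij}+x_j=\max_{k\in N}(a_{ik}+x_k)=x_i\}$. The tangent digraph $\mathcal{D}_{\mathbf{x}}$ has node set $\mathrm{Supp}(\mathbf{x})$ and arc set $E_{\mathbf{x}}=\{(j,i): i\in\mathrm{Supp}(\mathbf{x}),\ j\in V_{\mathbf{x}}(i)\}$. The arc $(j,i)$ is an outgoing arc of $j$ and an incoming arc of its endnode $i$; a loop is both. $\mathcal{D}^-_{\mathbf{x}}$ is obtained from $\mathcal{D}_{\mathbf{x}}$ by swapping the directions of all arcs. A node $i$ is variable (in $\mathcal{D}_{\mathbf{x}}$) if either it has no outgoing arc other than possibly $(i,i)$, or the endnode of any outgoing arc from $i$ except $(i,i)$ has another incoming arc. A set $W\subseteq\mathrm{Supp}(\mathbf{x})$ is isolated in $\mathcal{D}_{\mathbf{x}}$ if no arc of $\mathcal{D}_{\mathbf{x}}$ joins (in either direction) a node of $W$ and a node of $\mathrm{Supp}(\mathbf{x})\setminus W$. Jets: if a digraph $\mathcal{D}$ has one node $o$ with at least two outgoing arcs (one of which can be a loop) and all other nodes have exactly one outgoing arc and no loops, then each arc outgoing from $o$ gives rise to a jet, i.e. a path starting with that arc and ending with an elementary cycle. It is either a $\sigma$-jet (a path starting at $o$ and ending with an elementary cycle $\sigma$ not containing $o$) or an $o$-cycle (an elementary cycle containing $o$, possibly a loop on $o$). $\mathcal{D}_o$ is the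 subgraph of $\mathcal{D}$ consisting of all nodes accessible from $o$ (including $o$) and all arcs outgoing from these nodes. $\overline{\mathcal{D}}_o$ consists of all nodes and arcs of $\mathcal{D}_o$, all nodes of $\mathcal{D}$ having access to a node of $\mathcal{D}_o$, and all arcs outgoing from such nodes. $\mathcal{D}\setminus\overline{\mathcal{D}}_o$ is the subgraph consisting of all nodes and arcs not in $\overline{\mathcal{D}}_o$. Algorithm (input: $\mathbf{x}\in\mathscr{X}$; output: whether or not $\mathbf{x}$ is an extremal): 1. Construct $\mathcal{D}_{\mathbf{x}}$ and $\mathcal{D}^-_{\mathbf{x}}$. 2. If more than one node of $\mathcal{D}_{\mathbf{x}}$ is variable, return false. 3. If all nodes of $\mathcal{D}_{\mathbf{x}}$ have no more than one incoming arc: if $\mathrm{Supp}(\mathbf{x})$ has a nonempty proper subset isolated in $\mathcal{D}_{\mathbf{x}}$, return false; otherwise return true. 4. Find a node $o$ with $t\ge2$ outgoing arcs (one of which can be a loop) in $\mathcal{D}^-_{\mathbf{x}}$. Inspect all $t$ jets emanating from $o$ in $\mathcal{D}^-_{\mathbf{x}}$. If there are an $o$-cycle and a $\sigma$-jet, or there are a $\sigma_1$-jet and a $\sigma_2$-jet with $\sigma_1\neq\sigma_2$, return false. 5. Construct $\overline{\mathcal{D}}_o$ for $\mathcal{D}:=\mathcal{D}^-_{\mathbf{x}}$. If $\mathcal{D}\setminus\overline{\mathcal{D}}_o$ is non-empty, return false; otherwise return true. *)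

(* Defs.v *)
From mathcomp Require Import all_boot all_order all_algebra.
From mathcomp Require Import constructive_ereal reals.

Set Implicit Arguments.
Unset Strict Implicit.
Unset Printing Implicit Defensive.

Import Order.TTheory GRing.Theory Num.Theory.

(* R-bar = R u {-oo} is the part of \bar R without +oo; in \bar R one has
   a + (-oo) = -oo, and maxe is the max-plus addition. *)

Section MaxPlus.
Context {R : realType} {n : nat}.
Local Open Scope ereal_scope.
Implicit Types (A : 'M[\bar R]_n) (x y z : 'cV[\bar R]_n).

Definition mp_mulmx A x : 'cV[\bar R]_n :=
  \col_i \big[maxe/-oo]_(j < n) (A i j + x j ord0).

Definition mp_add x y : 'cV[\bar R]_n := \col_i maxe (x i ord0) (y i ord0).

Definition mp_zero : 'cV[\bar R]_n := const_mx -oo.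

Definition mp_matrix A : Prop := forall i j, A i j != +oo.
Definition mp_vector x : Prop := forall i, x i ord0 != +oo.

Definition scrX A : 'cV[\bar R]_n -> Prop :=
  fun x => [/\ mp_vector x,
               forall i, x i ord0 <= mp_mulmx A x i ord0
             & x <> mp_zero].

Definition scrX' A : 'cV[\bar R]_n -> Prop :=
  fun x => scrX A x \/ x = mp_zero.

Definition extremal (S : 'cV[\bar R]_n -> Prop) x : Prop :=
  S x /\ forall y z, S y -> S z -> x = mp_add y z -> x = y \/ x = z.

Definition supp x : {set 'I_n} := [set j | x j ord0 \is a fin_num].

End MaxPlus.

Record digraph (T : finType) := Digraph { nodes : {set T}; arc : rel T }.

Section Digraphs.
Context {T : finType}.
Implicit Types (D : digraph T) (i j o : T) (W : {set T}) (s c : seq T).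

Definition swap_arcs D : digraph T := Digraph (nodes D) (fun j i => arc D i j).

Definition outdeg D j : nat := #|[pred i | arc D j i]|.
Definition indeg D i : nat := #|[pred j | arc D j i]|.

Definition variable D i : Prop :=
  i \in nodes D /\
  ((forall k, arc D i k -> k = i) \/
   (forall k, arc D i k -> k != i -> exists2 j, j != i & arc D j k)).

Definition several_variable D : Prop :=
  exists i j, [/\ i != j, variable D i & variable D j].

Definition isolated D W : Prop :=
  W \subset nodes D /\
  forall i j, i \in W -> j \in nodes D :\: W -> ~~ arc D i j && ~~ arc D j i.

(* The elementary cycle c_0 -> c_1 -> ... -> c_(k-1) -> c_0; a loop is [:: i].
   As cycles, c and its rotations are the same. *)
Definition elementary_cycle D c : bool :=
  [&& c != [::], cycle (arc D) c & uniq c].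

Definition same_cycle c1 c2 : Prop := exists k, c2 = rot k c1.

(* The jet o -> s_0 -> ... -> c_0 -> ... -> c_0, which reaches c in c_0;
   s is empty when the first arc of the jet already enters c. *)
Definition sigma_jet D o s c : bool :=
  [&& path (arc D) o (s ++ c), elementary_cycle D c & uniq (o :: s ++ c)].

Definition o_cycle D o c : bool := elementary_cycle D c && (o \in c).

Definition mixed_jets D o : Prop :=
  (exists c s c', o_cycle D o c /\ sigma_jet D o s c') \/
  (exists s1 c1 s2 c2, [/\ sigma_jet D o s1 c1, sigma_jet D o s2 c2
                         & ~ same_cycle c1 c2]).

Definition accessible D j i : bool := connect (arc D) j i.

Definition outgoing_subgraph D W : digraph T :=
  Digraph W (fun j i => (j \in W) && arc D j i).

Definition sub_from D o : digraph T :=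
  outgoing_subgraph D [set i in nodes D | accessible D o i].

Definition sub_closure D o : digraph T :=
  outgoing_subgraph D
    [set j in nodes D | [exists i in nodes (sub_from D o), accessible D j i]].

Definition rest_nonempty D o : Prop :=
  (exists i, i \in nodes D :\: nodes (sub_closure D o)) \/
  (exists j i, arc D j i /\ ~~ arc (sub_closure D o) j i).

End Digraphs.

Section AlgorithmSteps.
Context {R : realType} {n : nat}.
Implicit Types (A : 'M[\bar R]_n) (x : 'cV[\bar R]_n).

Definition tangent_V A x (i : 'I_n) : {set 'I_n} :=
  [set j | ((A i j + x j ord0)%E == mp_mulmx A x i ord0) &&
           (mp_mulmx A x i ord0 == x i ord0)].

Definition tangent_digraph A x : digraph 'I_n :=
  Digraph (supp x) (fun j i => (i \in supp x) && (j \in tangent_V A x i)).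

(* The value returned by steps 1-5, in terms of digraphs and jets. *)
Inductive returns A x : bool -> Prop :=
| Step2_false :
    several_variable (tangent_digraph A x) -> returns A x false
| Step3_false (W : {set 'I_n}) :
    ~ several_variable (tangent_digraph A x) ->
    (forall i, i \in supp x -> indeg (tangent_digraph A x) i <= 1) ->
    W != set0 -> W \proper supp x -> isolated (tangent_digraph A x) W ->
    returns A x false
| Step3_true :
    ~ several_variable (tangent_digraph A x) ->
    (forall i, i \in supp x -> indeg (tangent_digraph A x) i <= 1) ->
    (forall W : {set 'I_n}, W != set0 -> W \proper supp x ->
       ~ isolated (tangent_digraph A x) W) ->
    returns A x true
| Step4_false (o : 'I_n) :
    ~ several_variable (tangent_digraph A x) ->
    o \in supp x -> 2 <= outdeg (swap_arcs (tangent_digraph A x)) o ->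
    mixed_jets (swap_arcs (tangent_digraph A x)) o ->
    returns A x false
| Step5_false (o : 'I_n) :
    ~ several_variable (tangent_digraph A x) ->
    o \in supp x -> 2 <= outdeg (swap_arcs (tangent_digraph A x)) o ->
    ~ mixed_jets (swap_arcs (tangent_digraph A x)) o ->
    rest_nonempty (swap_arcs (tangent_digraph A x)) o ->
    returns A x false
| Step5_true (o : 'I_n) :
    ~ several_variable (tangent_digraph A x) ->
    o \in supp x -> 2 <= outdeg (swap_arcs (tangent_digraph A x)) o ->
    ~ mixed_jets (swap_arcs (tangent_digraph A x)) o ->
    ~ rest_nonempty (swap_arcs (tangent_digraph A x)) o ->
    returns A x true.

End AlgorithmSteps.

(* Programs are trees of elementary operations, so that the operations are
   counted by recursion on the program. The type V of scalars and the type
   family arr of node-indexed arrays are abstract for the program: it can use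
   them only through the operations below. *)

Section Programs.
Context {n : nat} {V : Type} {arr : Type -> Type}.

Inductive elementary : Type -> Type :=
| Add of V & V : elementary V
| Leq of V & V : elementary bool
(* step to the next entry of a list of nodes, or to the next arc of a list of
   incoming or outgoing arcs *)
| Visit of 'I_n : elementary unit
| Same_node of 'I_n & 'I_n : elementary bool
| Get T of arr T & 'I_n : elementary T
| Put T of arr T & 'I_n & T : elementary (arr T)
| Fill T of T : elementary (arr T).

Inductive prog (T : Type) : Type :=
| Ret of T
| Do S of elementary S & (S -> prog T).

Fixpoint bind S T (p : prog S) (f : S -> prog T) : prog T :=
  match p with
  | Ret s => f s
  | Do _ e k => Do e (fun u => bind (k u) f)
  end.

Definition op S (e : elementary S) : prog S := Do e (fun s => Ret s).

(* Filling a new array is n operations, every other operation is one. *)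
Definition weight S (e : elementary S) : nat :=
  if e is Fill _ _ then n else 1.

End Programs.

Arguments elementary : clear implicits.
Arguments prog : clear implicits.
Arguments Ret {n V arr T}.

Declare Scope prog_scope.
Delimit Scope prog_scope with prog.
Notation "'let!' v := p 'in' q" := (bind p (fun v => q))
  (at level 200, v pattern, p at level 100, q at level 200,
   format "'[v' 'let!'  v  :=  p  'in' '/' q ']'") : prog_scope.
Local Open Scope prog_scope.

(* Arrays are functions on the nodes; a program never reads an array again
   after having updated it. *)
Section Execution.
Context {n : nat} {V : Type}.
Variables (add : V -> V -> V) (leq : V -> V -> bool).

Definition farray (T : Type) : Type := 'I_n -> T.

Definition exec S (e : elementary n V farray S) : S :=
  match e in elementary _ _ _ S return S with
  | Add a b => add a b
  | Leq a b => leq a b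
  | Visit _ => tt
  | Same_node u v => u == v
  | Get _ f u => f u
  | Put _ f u t => fun v => if v == u then t else f v
  | Fill _ t => fun=> t
  end.

Fixpoint result T (p : prog n V farray T) : T :=
  match p with
  | Ret t => t
  | Do _ e k => result (k (exec e))
  end.

Fixpoint cost T (p : prog n V farray T) : nat :=
  match p with
  | Ret _ => 0
  | Do _ e k => weight e + cost (k (exec e))
  end.

End Execution.

Section Algorithm.
Context {n : nat} {V : Type} {arr : Type -> Type}.
Variable ninf : V.
Local Notation prog := (prog n V arr).
Local Notation node := 'I_n.

Fixpoint fold_nodes S (f : S -> node -> prog S) (st : S) (l : seq node) :
    prog S :=
  if l is u :: l' then
    let! _ := op (Visit u) in
    let! st' := f st u in
    fold_nodes f st' l'
  else Ret st.

Fixpoint all_nodes (p : node -> prog bool) (l : seq node) : prog bool :=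
  if l is u :: l' then
    let! _ := op (Visit u) in
    let! b := p u in
    if b then all_nodes p l' else Ret false
  else Ret true.

Fixpoint find_node (p : node -> prog bool) (l : seq node) :
    prog (option node) :=
  if l is u :: l' then
    let! _ := op (Visit u) in
    let! b := p u in
    if b then Ret (Some u) else find_node p l'
  else Ret None.

Definition filter_nodes (p : node -> prog bool) (l : seq node) :
    prog (seq node) :=
  fold_nodes (fun st u => let! b := p u in Ret (if b then u :: st else st))
    [::] l.

Fixpoint several_nodes (p : node -> prog bool) (seen : bool) (l : seq node) :
    prog bool :=
  if l is u :: l' then
    let! _ := op (Visit u) in
    let! b := p u in
    if b && seen then Ret true else several_nodes p (b || seen) l'
  else Ret false.

Definition at_least_two (l : seq node) : prog bool :=
  if l is u :: l' then
    let! _ := op (Visit u) in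
    if l' is w :: _ then
      let! _ := op (Visit w) in Ret true
    else Ret false
  else Ret false.

Definition equal (a b : V) : prog bool :=
  let! c := op (Leq a b) in
  if c then op (Leq b a) else Ret false.

(* outs u lists the endnodes of the arcs outgoing from u, ins u the initial
   nodes of the arcs incoming to u. *)
Record adjacency := Adjacency {
  node_list : seq node;
  outs : arr (seq node);
  ins : arr (seq node)
}.

(* No copying: the two arrays represent the digraph and its reverse at once. *)
Definition reversed (D : adjacency) : adjacency :=
  Adjacency (node_list D) (ins D) (outs D).

Definition term (row x : arr V) (j : node) : prog V :=
  let! a := op (Get row j) in
  let! xj := op (Get x j) in
  op (Add a xj).

Definition row_max (row x : arr V) : prog V :=
  fold_nodes (fun m j =>
    let! s := term row x j in
    let! b := op (Leq m s) in
    Ret (if b then s else m)) ninf (enum 'I_n).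

Definition add_node (D : adjacency) (i : node) : adjacency :=
  Adjacency (i :: node_list D) (outs D) (ins D).

Definition add_arc (D : adjacency) (j i : node) : prog adjacency :=
  let! lo := op (Get (outs D) j) in
  let! no := op (Put (outs D) j (i :: lo)) in
  let! li := op (Get (ins D) i) in
  let! ni := op (Put (ins D) i (j :: li)) in
  Ret (Adjacency (node_list D) no ni).

(* step 1 *)
Definition build_tangent (A : arr (arr V)) (x : arr V) : prog adjacency :=
  let! outs0 := op (Fill [::]) in
  let! ins0 := op (Fill [::]) in
  fold_nodes (fun D i =>
    let! xi := op (Get x i) in
    let! infinite := op (Leq xi ninf) in
    if infinite then Ret D else
    let! row := op (Get A i) in
    let! m := row_max row x in
    let! active := equal m xi in
    if active then
      fold_nodes (fun D j =>
        let! s := term row x j in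
        let! b := equal s m in
        if b then add_arc D j i else Ret D) (add_node D i) (enum 'I_n)
    else Ret (add_node D i))
  (Adjacency [::] outs0 ins0) (enum 'I_n).

Definition is_variable (D : adjacency) (i : node) : prog bool :=
  let! lo := op (Get (outs D) i) in
  all_nodes (fun k =>
    let! loop := op (Same_node k i) in
    if loop then Ret true else
    let! lk := op (Get (ins D) k) in
    at_least_two lk) lo.

Definition branching (D : adjacency) (i : node) : prog bool :=
  let! lo := op (Get (outs D) i) in at_least_two lo.

(* Graph search from the nodes in starts along the arcs listed in the arrays
   adjs; the result marks the nodes reached. A search state is the list of
   nodes to be processed and the marks. *)
Definition touch (st : seq node * arr bool) (v : node) :
    prog (seq node * arr bool) :=
  let! marked := op (Get st.2 v) in
  if marked then Ret st else
  let! marks := op (Put st.2 v true) in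
  Ret (v :: st.1, marks).

Fixpoint expand (adjs : seq (arr (seq node))) (u : node)
    (st : seq node * arr bool) : prog (seq node * arr bool) :=
  if adjs is adj :: adjs' then
    let! l := op (Get adj u) in
    let! st' := fold_nodes touch st l in
    expand adjs' u st'
  else Ret st.

Fixpoint search (fuel : nat) (adjs : seq (arr (seq node)))
    (todo : seq node) (marks : arr bool) : prog (arr bool) :=
  if fuel is fuel'.+1 then
    if todo is u :: todo' then
      let! _ := op (Visit u) in
      let! st := expand adjs u (todo', marks) in
      search fuel' adjs st.1 st.2
    else Ret marks
  else Ret marks.

Definition reach (adjs : seq (arr (seq node))) (starts : seq node) :
    prog (arr bool) :=
  let! marks := op (Fill false) in
  let! st := fold_nodes touch ([::], marks) starts in
  search n adjs st.1 st.2.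

(* The support has a nonempty proper isolated subset iff a search from one of
   its nodes, ignoring the directions of the arcs, does not reach all of it. *)
Definition no_isolated_subset (D : adjacency) : prog bool :=
  if node_list D is u :: _ then
    let! marks := reach [:: outs D; ins D] [:: u] in
    all_nodes (fun v => op (Get marks v)) (node_list D)
  else Ret true.

(* Follow the jet whose first arc enters u: None for an o-cycle, otherwise the
   first node met twice, which lies on the final cycle. *)
Fixpoint follow (fuel : nat) (D : adjacency) (o u : node) (marks : arr bool) :
    prog (option node) :=
  if fuel is fuel'.+1 then
    let! back := op (Same_node u o) in
    if back then Ret None else
    let! marked := op (Get marks u) in
    if marked then Ret (Some u) else
    let! marks' := op (Put marks u true) in
    let! lo := op (Get (outs D) u) in
    if lo is w :: _ then
      let! _ := op (Visit w) in
      follow fuel' D o w marks'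
    else Ret (Some u)
  else Ret (Some u).

Definition jet (D : adjacency) (o u : node) : prog (option node) :=
  let! marks := op (Fill false) in follow n D o u marks.

Fixpoint mark_cycle (fuel : nat) (D : adjacency) (u : node)
    (marks : arr bool) : prog (arr bool) :=
  if fuel is fuel'.+1 then
    let! marked := op (Get marks u) in
    if marked then Ret marks else
    let! marks' := op (Put marks u true) in
    let! lo := op (Get (outs D) u) in
    if lo is w :: _ then
      let! _ := op (Visit w) in
      mark_cycle fuel' D w marks'
    else Ret marks'
  else Ret marks.

(* Nodes other than o have one outgoing arc, so the cycle of a jet equals the
   cycle of the first jet as soon as they share a node. *)
Definition jets_agree (D : adjacency) (o : node) : prog bool :=
  let! lo := op (Get (outs D) o) in
  if lo is u :: lo' then
    let! _ := op (Visit u) in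
    let! first := jet D o u in
    match first with
    | None =>
        all_nodes (fun v =>
          let! r := jet D o v in Ret (~~ isSome r)) lo'
    | Some w =>
        let! empty_marks := op (Fill false) in
        let! sigma := mark_cycle n D w empty_marks in
        all_nodes (fun v =>
          let! r := jet D o v in
          if r is Some w' then op (Get sigma w') else Ret false) lo'
    end
  else Ret true.

(* The difference is empty iff it has no node, since the closure of the subgraph
   contains all arcs outgoing from its nodes. *)
Definition rest_empty (D : adjacency) (o : node) : prog bool :=
  let! from_o := reach [:: outs D] [:: o] in
  let! lo := filter_nodes (fun v => op (Get from_o v)) (node_list D) in
  let! closure := reach [:: ins D] lo in
  all_nodes (fun v => op (Get closure v)) (node_list D).

(* Step 3 applies exactly when the search for the node o of step 4 fails. *)
Definition check_extremal (A : arr (arr V)) (x : arr V) : prog bool :=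
  let! D := build_tangent A x in
  let! several := several_nodes (is_variable D) false (node_list D) in
  if several then Ret false else
  let Dminus := reversed D in
  let! found := find_node (branching Dminus) (node_list D) in
  if found is Some o then
    let! agree := jets_agree Dminus o in
    if agree then rest_empty Dminus o else Ret false
  else no_isolated_subset D.

End Algorithm.

Section Run.
Context {R : realType} {n : nat}.
Implicit Types (A : 'M[\bar R]_n) (x : 'cV[\bar R]_n).
Local Open Scope ereal_scope.

Definition algorithm A x : prog n (\bar R) farray bool :=
  check_extremal (arr := farray) -oo (fun i j => A i j) (fun i => x i ord0).

Definition algorithm_result A x : bool :=
  result (fun a b => a + b) (fun a b => a <= b) (algorithm A x).

Definition operations A x : nat :=
  cost (fun a b => a + b) (fun a b => a <= b) (algorithm A x).

End Run.

(* Main.v *)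
(* Lowering [x] slightly outside a set [U] of nodes stays in [scrX] iff every
   node of [U] with an incoming arc has one coming from [U] ("[U] is retained").
   Hence [x] is extremal iff its support is not the union of two proper retained
   sets. If at most one node is variable, each other node [i] has an arc to a
   node [c i != i] whose only incoming arc comes from [i], and [c] is injective.
   A set free of variable nodes whose complement is retained is therefore
   permuted by [c]. When all indegrees are at most one, such a set is isolated;
   otherwise there is one branching node [o], all nodes but [o] have a unique
   successor in the reversed digraph, and such a set consists of cycles of that
   digraph, which either not all jets of [o] enter or which are not accessible
   from [o]. Each graph search marks a node at most once, so all the steps are
   quadratic. *)

Require Import Defs.
From mathcomp Require Import all_boot all_order all_algebra.
From mathcomp Require Import constructive_ereal reals.
From mathcomp Require Import zify lra.

(* [mathcomp.boot.path] also defines [arc] and would shadow that of [Defs]. *)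
Import Defs.
Import Order.TTheory GRing.Theory Num.Theory.

Set Implicit Arguments.
Unset Strict Implicit.
Unset Printing Implicit Defensive.

(** * Retained sets *)

(** The obstacle is the test on jets. [mixed_jets] speaks of all pairs of jets, the program compares
    each jet with the first one only, and irreducibility does not mention jets. The notion
    [separating] mediates: a disagreement found by the program gives mixed jets, mixed jets give a
    separating set, and a separating set forces the program to find a disagreement. This circle
    makes the three equivalent, and a separating set refutes irreducibility at once. All branches
    are judged against [union_irreducible], a property of the tangent digraph alone; max-plus
    algebra enters only in its equivalence with extremality. There the decrease must be slight
    because of the nodes without incoming arc: the row maximum strictly exceeds the component, and
    this excess bounds the decrease. *)

Section Retained.
Context {T : finType} (D : digraph T).
Implicit Types (U W Z : {set T}) (i j k o u : T).

(** The record [digraph] does not force arcs to join nodes. *)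
Definition arcs_in_nodes : Prop :=
  forall j i, arc D j i -> (j \in nodes D) && (i \in nodes D).

Definition retained U : Prop :=
  U \subset nodes D /\
  forall i j, i \in U -> arc D j i -> exists2 k, k \in U & arc D k i.

Definition union_irreducible : Prop :=
  forall U1 U2, retained U1 -> retained U2 -> U1 :|: U2 = nodes D ->
    U1 = nodes D \/ U2 = nodes D.

(** Such an arc witnesses that [i] is not variable: without [i], the node [k] would lose its only
    incoming arc. *)
Definition critical i k : bool :=
  [&& k != i, arc D i k & [forall j, arc D j k ==> (j == i)]].

Hypothesis wfD : arcs_in_nodes.

Lemma criticalP i k :
  reflect [/\ k != i, arc D i k & forall j, arc D j k -> j = i]
          (critical i k).
Proof.
apply: (iffP and3P) => -[ki ik H]; split=> //.
  by move=> j jk; apply/eqP; exact: (implyP (forallP H j)).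
by apply/forallP=> j; apply/implyP=> /H ->.
Qed.

(** The first alternative in [variable] is the vacuous case of the second, so the absence of
    critical arcs captures both. *)
Lemma variableP i :
  reflect (variable D i) ((i \in nodes D) && [forall k, ~~ critical i k]).
Proof.
apply: (iffP andP) => [[iD /forallP ncrit]|[iD vi]]; split=> //.
  right=> k ik ki; have /nandP[|/nandP[|/forallPn[j]]] := ncrit k.
  - by rewrite ki.
  - by rewrite ik.
  by rewrite negb_imply => /andP[jk ji]; exists j.
apply/forallP=> k; apply/negP=> /criticalP[ki ik H]; case: vi => lo.
  by rewrite (lo _ ik) eqxx in ki.
by have [j /eqP ji jk] := lo _ ik ki; apply: ji; exact: H.
Qed.

(** Every other node that has an arc from [i] keeps an incoming arc from elsewhere when [i] is
    removed. *)
Lemma variable_retained i : variable D i -> retained (nodes D :\ i).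
Proof.
move=> [iD vi]; split=> [|k j]; first exact: subsetDl.
rewrite !inE => /andP[ki kD] jk.
have [ji|ji] := eqVneq j i; last first.
  by exists j => //; rewrite !inE ji; case/andP: (wfD jk).
rewrite {}ji in jk; case: vi => [/(_ _ jk) kE|/(_ _ jk ki)[l li lk]].
  by rewrite kE eqxx in ki.
by exists l => //; rewrite !inE li; case/andP: (wfD lk).
Qed.

Lemma several_variable_reducible : several_variable D -> ~ union_irreducible.
Proof.
move=> [i [j [ij vi vj]]].
move=> irr; 
have := irr _ _ (variable_retained vi) (variable_retained vj).
case=> [||].
- apply/setP=> k; rewrite !inE.
  by rewrite -andb_orl -negb_and; have [->|//] := eqVneq k i; rewrite ij.
- by case: vi => iD _ /setP/(_ i); rewrite !inE eqxx iD.
- by case: vj => jD _ /setP/(_ j); rewrite !inE eqxx jD.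
Qed.

Lemma complement_reducible U :
  retained U -> retained (nodes D :\: U) -> U != set0 -> U != nodes D ->
  ~ union_irreducible.
Proof.
move=> rU rUc U0 UD irr; have := irr _ _ rU rUc; have UsD := rU.1.
rewrite setDE setUIr setUCr setIT (setUidPr UsD) => /(_ erefl)[/eqP|].
  by apply/negP.
move=> /setIidPl; rewrite -disjoints_subset => /disjoint_setI0.
by rewrite (setIidPr UsD) => /eqP; apply/negP.
Qed.

Lemma isolated_reducible W :
  W != set0 -> W \proper nodes D -> isolated D W -> ~ union_irreducible.
Proof.
move=> W0 WD [WsD iso]; apply: (@complement_reducible W) => //.
- split=> // i j iW ji; exists j => //.
  have /andP[jD iD] := wfD ji; apply: contraLR ji => jW.
  by have := iso i j iW; rewrite inE jW jD => /(_ isT)/andP[].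
- split=> [|i j]; first exact: subsetDl.
  rewrite inE => /andP[iW iD] ji; exists j => //.
  have /andP[jD _] := wfD ji; rewrite inE jD andbT.
  apply: contraL ji => jW.
  by have := iso j i jW; rewrite inE iW iD => /(_ isT)/andP[/negPf->].
- by rewrite eqEproper WD andbF.
Qed.

(** The default [i] is never critical for [i], so [critical i (critical_end i)] also tests whether a
    critical arc exists. *)
Definition critical_end i : T := odflt i [pick k | critical i k].

Lemma critical_endP i : i \in nodes D -> ~ variable D i ->
  critical i (critical_end i).
Proof.
move=> iD nv; rewrite /critical_end; case: pickP => //= ncrit.
by case: nv; apply/variableP; rewrite iD; apply/forallP=> k; rewrite ncrit.
Qed.

Lemma critical_inj i j k : critical i k -> critical j k -> i = j.
Proof. by move=> /criticalP[_ ik _] /criticalP[_ _ /(_ _ ik)]. Qed.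

Lemma critical_end_inj : {in [pred i | critical i (critical_end i)] &,
  injective critical_end}.
Proof.
by move=> i j; rewrite !inE => ci + ce; rewrite -ce; exact: critical_inj.
Qed.

(* [critical_end] maps such a [W] into itself injectively, hence onto itself. *)
Lemma lost_critical W : retained (nodes D :\: W) -> W \subset nodes D ->
  (forall i, i \in W -> ~ variable D i) ->
  {in W, forall k, exists2 i, i \in W & critical i k}.
Proof.
move=> [_ rW] WD nv.
have cW i : i \in W -> critical i (critical_end i).
  by move=> iW; apply: critical_endP (nv _ iW); exact: (subsetP WD).
have sW : critical_end @: W \subset W.
  apply/subsetP=> _ /imsetP[i iW ->].
  have /criticalP[_ ik sole] := cW _ iW.
  (* If [k] were outside [W], the retained complement would contain a source of an arc to [k]; but
     the only source is [i], which is in [W]. *)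
  have /andP[_ kD] := wfD ik; apply: contraT => kW.
  have [j jU /sole ji] := rW _ i (introT setDP (conj kD kW)) ik.
  by rewrite ji !inE iW in jU.
have eW : critical_end @: W = W.
  apply/eqP; rewrite eqEcard sW card_in_imset ?leqnn // => i j iW jW.
  by apply: critical_end_inj; exact: cW.
move=> k; rewrite -{1}eW => /imsetP[i iW ->]; exists i => //; exact: cW.
Qed.

(** Two retained sets that cover the nodes have disjoint complements. If each complement contained a
    variable node, these two nodes would be distinct; so one complement contains none and plays the
    role of [W]. *)
Lemma union_irreducible_lost : ~ several_variable D ->
  (forall W, W != set0 -> W \proper nodes D -> retained (nodes D :\: W) ->
     (forall i, i \in W -> ~ variable D i) -> False) ->
  union_irreducible.
Proof.
move=> nsev nlost U1 U2 r1 r2 U12.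
have [/eqP|n1] := boolP (U1 == nodes D); first by left.
have [/eqP|n2] := boolP (U2 == nodes D); first by right.
case: nsev.
suff lostv U U' : retained U -> retained U' -> U :|: U' = nodes D ->
    U != nodes D -> U' != nodes D ->
    exists2 i, i \notin U & variable D i.
  have [i iU1 vi] := lostv _ _ r1 r2 U12 n1 n2.
  have U21 : U2 :|: U1 = nodes D by rewrite setUC.
  have [j jU2 vj] := lostv _ _ r2 r1 U21 n2 n1.
  exists i, j; split=> //; apply: contraNneq jU2 => <-.
  have [+ _] := vi; rewrite -U12 inE; case/orP=> // iU1'.
  by rewrite iU1' in iU1.
move=> {}r1 {}r2 {}U12 {}n1 {}n2; have UD := r1.1; have U'D := r2.1.
set W := nodes D :\: U.
have WK : nodes D :\: W = U.
  by rewrite setDE setCD setIUr setICr set0U; apply/setIidPr.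
have W0 : W != set0.
  by rewrite setD_eq0; apply: contra n1 => DU; rewrite eqEsubset UD.
(* If [W] were everything, [U] would be empty and [U'] would be everything. *)
have WD : W \proper nodes D.
  rewrite properEneq subsetDl andbT; apply: contra n2 => /eqP WE.
  rewrite eqEsubset U'D -U12 subUset subxx andbT -WK WE setDv; exact: sub0set.
have [/existsP[i /andP[iW vi]]|nv] := boolP [exists i,
    (i \in W) && ((i \in nodes D) && [forall k, ~~ critical i k])].
  by exists i; [move: iW; rewrite inE => /andP[]|exact/variableP].
case: (nlost W) => // [|i iW /variableP vi]; first by rewrite WK.
by case/existsP: nv; exists i; rewrite iW.
Qed.

(** An arc leaving [W] would give its endnode a second incoming arc, from the retained complement.
    An arc entering [W] is excluded because each node of [W] has its only incoming arc from [W]. *)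
Lemma unisolated_irreducible : ~ several_variable D ->
  (forall i, i \in nodes D -> indeg D i <= 1) ->
  (forall W, W != set0 -> W \proper nodes D -> ~ isolated D W) ->
  union_irreducible.
Proof.
move=> nsev deg1 niso; apply: union_irreducible_lost => // W W0 WD rW nvW.
have WsD := proper_sub WD; have critW := lost_critical rW WsD nvW.
case: (niso W) => //; split=> // i j iW; rewrite inE => /andP[jW jD].
apply/andP; split; apply/negP=> ij.
  have [k kU kj] := rW.2 j i (introT setDP (conj jD jW)) ij.
  have: [set i; k] \subset [pred l | arc D l j].
    by apply/subsetP=> l; rewrite !inE => /orP[]/eqP->.
  move=> /subset_leq_card/leq_trans/(_ (deg1 _ jD)).
  rewrite cards2; case: eqP => // ik.
  by move: kU; rewrite -ik inE iW.
have [k kW /criticalP[_ ki sole]] := critW i iW.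
by rewrite (sole _ ij) kW in jW.
Qed.

End Retained.

(** * A branching node *)

Section Branching.
Context {T : finType} (D : digraph T) (o : T).
Implicit Types (U W Z : {set T}) (i j k u w : T) (s c p : seq T).

Hypothesis wfD : arcs_in_nodes D.

Let Dm : digraph T := swap_arcs D.

(* [Z] collects cycles of [Dm] that some, but not all, jets of [o] enter. *)
Definition separating Z : Prop :=
  [/\ Z \subset nodes D, o \notin Z,
      forall i k, arc Dm i k -> i != o -> (i \in Z) = (k \in Z),
      exists2 u, u \in Z & arc Dm o u
    & exists2 u, u \notin Z & arc Dm o u].

(** Both [Z] and its complement are retained: in [D], every node but [o] has all its predecessors on
    its own side, and [o], which is outside [Z], keeps the predecessor [w] there. *)
Lemma separating_reducible Z : separating Z -> ~ union_irreducible D.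
Proof.
case=> ZD oZ side [u uZ ou] [w wZ ow].
apply: (@complement_reducible _ _ Z) => //.
- split=> // i j iZ ji; exists j => //.
  by rewrite -(side i j ji) //; apply: contraNneq oZ => <-.
- split=> [|i j]; first exact: subsetDl.
  rewrite inE => /andP[iZ iD] ji; have [io|io] := eqVneq i o.
    exists w; last by rewrite io.
    by rewrite inE wZ; case/andP: (wfD ow).
  by exists j => //; rewrite inE -(side i j ji io) iZ; case/andP: (wfD ji).
- by apply/set0Pn; exists u.
- by apply: contraNneq oZ => ->; case/andP: (wfD ou).
Qed.

(** The closure [C] and its complement are both retained. A node outside [C] has all its
    [Dm]-successors outside, since access to a node of [C] would put it in [C]. *)
Lemma rest_nonempty_reducible : o \in nodes D ->
  rest_nonempty Dm o -> ~ union_irreducible D.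
Proof.
move=> oD rest; set C := nodes (sub_closure Dm o).
have inC j : (j \in C) = (j \in nodes D) &&
    [exists i, [&& i \in nodes D, connect (arc Dm) o i & connect (arc Dm) j i]].
  by rewrite inE; congr (_ && _); apply: eq_existsb => i; rewrite inE -andbA.
have wfDm i j : arc Dm i j -> (i \in nodes D) * (j \in nodes D).
  by move=> /wfD/andP[-> ->].
apply: (@complement_reducible _ _ C) => //.
- split=> [|i j]; first by apply/subsetP=> j; rewrite inC => /andP[].
  rewrite inC => /andP[iD /existsP[k /and3P[kD ok]]].
  (* If the path is empty, [i] is accessible from [o], hence so is [j]. Otherwise the next node [l]
     of the path is the neighbour wanted. *)
  case/connectP=> -[|l p] /= pth lst.
    move=> ij; exists j => //; rewrite inC (wfDm i j ij) /=.
    apply/existsP; exists j; rewrite (wfDm i j ij) connect0 andbT /=.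
    by apply: connect_trans ok _; rewrite lst; exact: connect1.
  move=> _; case/andP: pth => il pth; exists l => //.
  rewrite inC (wfDm i l il); apply/existsP; exists k; rewrite kD ok.
  by apply/connectP; exists p.
- split=> [|i j]; first exact: subsetDl.
  rewrite inE => /andP[iC iD] ij; exists j => //.
  rewrite inE (wfDm i j ij) andbT; apply: contra iC; rewrite !inC iD.
  case/andP=> _ /existsP[k /and3P[kD ok jk]].
  apply/existsP; exists k; rewrite kD ok /=.
  exact: connect_trans (connect1 _) jk.
- apply/set0Pn; exists o; rewrite inC oD.
  by apply/existsP; exists o; rewrite oD !connect0.
(* A missing arc also gives a missing node, namely its source. *)
- case: rest => [[i]|[i [j [ij]]]].
    by rewrite inE -/C => /andP[iC iD]; apply: contraNneq iC => ->.
  rewrite -[arc (sub_closure _ _) _ _]/((i \in C) && arc Dm i j) ij andbT.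
  by apply: contraNneq => ->; rewrite (wfDm i j ij).
Qed.

Hypothesis nsev : ~ several_variable D.
Hypothesis deg_o : 1 < outdeg Dm o.

(** The endnode of a critical arc has indegree one in [D], whereas [outdeg Dm o] is the indegree of
    [o] in [D]. *)
Lemma critical_not_branching i k : critical D i k -> k != o.
Proof.
move=> /criticalP[_ _ sole]; apply: contraTneq deg_o => ko.
rewrite -leqNgt; apply: (@leq_trans #|pred1 i|); last by rewrite card1.
by apply/subset_leq_card/subsetP=> j; rewrite !inE => jo;
  apply/eqP/sole; rewrite ko.
Qed.

(* Each nonvariable node is the source of a critical arc; as all nodes but at
   most one are nonvariable, the endnodes of these arcs exhaust all nodes but
   [o]. *)
Lemma critical_source k : k \in nodes D -> k != o ->
  exists i, k = critical_end D i /\ critical D i k.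
Proof.
pose N := [set i in nodes D | critical D i (critical_end D i)].
have sub : critical_end D @: N \subset nodes D :\ o.
  apply/subsetP=> _ /imsetP[i iN ->]; move: iN; rewrite inE => /andP[iD ci].
  rewrite !inE (critical_not_branching ci).
  by have /criticalP[_ /wfD/andP[]] := ci.
move=> kD ko; have kDo : k \in nodes D :\ o by rewrite !inE ko.
have oD : o \in nodes D.
  have [j /wfD/andP[]//|oj] := @pickP _ [pred i | arc Dm o i].
  by move: deg_o; rewrite /outdeg (eq_card oj) card0.
suff eN : critical_end D @: N = nodes D :\ o.
  move: kDo; rewrite -eN => /imsetP[i]; rewrite inE => /andP[_ ci] ->.
  by exists i.
apply/eqP; rewrite eqEcard sub card_in_imset; last first.
  move=> i j; rewrite !inE => /andP[_ ci] /andP[_ cj].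
  exact: critical_end_inj.
have NVD : N \subset nodes D by apply/subsetP=> i; rewrite inE => /andP[].
have : #|nodes D :\: N| <= 1.
  rewrite leqNgt; apply/negP=> /card_gt1P[i [j [iN jN ij]]]; apply: nsev.
  move: iN jN; rewrite !inE => /andP[ci iD] /andP[cj jD].
  have var l : l \in nodes D -> ~~ critical D l (critical_end D l) ->
      variable D l.
    move=> lD cl; apply/variableP; rewrite lD; apply/forallP=> m.
    by apply: contra cl => clm; rewrite /critical_end;
      case: pickP => // /(_ m); rewrite clm.
  by exists i, j; split=> //; apply: var => //; move: ci cj; rewrite iD jD.
(* At most one node lies outside [N], so [N] is at least as large as [nodes D :\ o], and the
   injective image of [N] fills this set. *)
have := cardsD1 o (nodes D); rewrite oD /=.
have := cardsID N (nodes D); rewrite (setIidPr NVD).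
by move=> <-; rewrite addnC add1n; lia.
Qed.

Lemma arc_sole i j k : arc Dm k i -> arc Dm k j -> k != o -> i = j.
Proof.
move=> ki kj ko; have /andP[_ kD] := wfD ki.
have [l [_ /criticalP[_ _ sole]]] := critical_source kD ko.
by rewrite (sole _ ki) (sole _ kj).
Qed.

(** Each of [i] and [j] is the [critical_end] of its only predecessor in [D], which is [k] for
    both. *)
Lemma arc_sole_source i j k : arc Dm i k -> arc Dm j k -> i != o -> j != o ->
  i = j.
Proof.
move=> ik jk io jo; have /andP[_ iD] := wfD ik; have /andP[_ jD] := wfD jk.
have [l [iE /criticalP[_ _ sole]]] := critical_source iD io.
have [l' [jE /criticalP[_ _ sole']]] := critical_source jD jo.
by rewrite iE jE -(sole _ ik) -(sole' _ jk).
Qed.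

Section Sides.
Variable Z : {set T}.
Hypothesis oZ : o \notin Z.
Hypothesis side : forall i k, arc Dm i k -> i != o -> (i \in Z) = (k \in Z).

(** Only the sources of the arcs have to differ from [o]. The last node may be [o], as on an
    [o]-cycle. *)
Lemma path_side u p : path (arc Dm) u p -> o \notin belast u p ->
  {in u :: p, forall w, (w \in Z) = (u \in Z)}.
Proof.
elim: p u => [|v p IH] u /=; first by move=> _ _ w; rewrite inE => /eqP->.
case/andP=> uv pth; rewrite inE negb_or eq_sym => /andP[uo ov] w.
rewrite inE => /predU1P[->//|wp]; rewrite (side uv uo).
exact: IH.
Qed.

(** The cycle returns to [o], which is outside [Z], and the side is constant on the way. The default
    [o] of [head] covers a loop. *)
Lemma o_cycle_side p : path (arc Dm) o (rcons p o) -> uniq (o :: p) ->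
  head o p \notin Z.
Proof.
case: p => [//|v p] /=; case/andP=> _ pth /and3P[oP _ _].
rewrite -(path_side pth _ (x := o)) //; first by rewrite belast_rcons.
by rewrite inE mem_rcons inE eqxx orbT.
Qed.

Lemma sigma_jet_side s c : sigma_jet Dm o s c ->
  {in s ++ c, forall w, (w \in Z) = (head o (s ++ c) \in Z)}.
Proof.
case/and3P; case: (s ++ c) => [//|v p] /= /andP[_ pth] _ /and3P[op _ _].
apply: path_side => //; apply: contra op => /mem_belast; exact.
Qed.

End Sides.

(** Off [o], successors are unique and so are predecessors; hence such a cycle is never left and can
    be entered from [o] only. *)
Lemma elementary_cycle_side c : elementary_cycle Dm c -> o \notin c ->
  forall i k, arc Dm i k -> i != o -> (i \in c) = (k \in c).
Proof.
case/and3P=> _ cyc _ oc i k ik io; apply/idP/idP => [ic|kc].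
  by rewrite -(arc_sole (next_cycle cyc ic) ik io) mem_next.
rewrite -(arc_sole_source (prev_cycle cyc kc) ik _ io) ?mem_prev //.
by apply: contraNneq oc => <-; rewrite mem_prev.
Qed.

Lemma elementary_cycle_uniq x p q : elementary_cycle Dm (x :: p) ->
  elementary_cycle Dm (x :: q) -> o \notin x :: p -> o \notin x :: q -> p = q.
Proof.
(* Both cycles are orbits of the successor function [f] from [x]; they have the same length, the
   order of [x], and so coincide. *)
pose f k := odflt k [pick i | arc Dm k i].
have fE c : elementary_cycle Dm c -> o \notin c -> fcycle f c.
  case/and3P=> _ cyc _ oc; move: cyc.
  apply: (@sub_in_cycle _ (mem c)); last exact: allss.
  move=> i k ic _ ik /=.
  rewrite /f; case: pickP => [j ij|/(_ k)]; last by rewrite ik.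
  by rewrite (arc_sole ij ik) //; apply: contraNneq oc => <-.
move=> cp cq op oq; have [_ _ up] := and3P cp; have [_ _ uq] := and3P cq.
have [fp fq] := (fE _ cp op, fE _ cq oq).
have := order_cycle fp up (mem_head x p).
rewrite (order_cycle fq uq (mem_head x q)) => -[sz].
have [n pE] := fpathP fp; have [m qE] := fpathP fq.
have := congr1 size pE; have := congr1 size qE.
rewrite !size_traject !size_rcons => qm pn.
by move: pE; rewrite -pn -sz qm -qE => /rcons_inj[].
Qed.

Lemma same_cycle_meet c1 c2 :
  elementary_cycle Dm c1 -> elementary_cycle Dm c2 ->
  o \notin c1 -> o \notin c2 -> head o c2 \in c1 -> same_cycle c1 c2.
Proof.
case: c2 => [//|x q] e1 e2 o1 o2 /= /rot_to[k p kE]; exists k.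
have e1' : elementary_cycle Dm (x :: p).
  by have [/= _ cyc uq] := and3P e1; rewrite -kE /elementary_cycle
    rot_cycle rot_uniq cyc uq kE.
rewrite kE (elementary_cycle_uniq e1' e2) // -kE mem_rot //.
Qed.

Lemma sigma_jet_head s c : sigma_jet Dm o s c -> arc Dm o (head o (s ++ c)).
Proof.
case/and3P; case: s => [|v s] /=; last by case/andP.
by case: c => // x c /= /andP[].
Qed.

Lemma o_cycle_rot c : o_cycle Dm o c ->
  exists p, path (arc Dm) o (rcons p o) /\ uniq (o :: p).
Proof.
case/andP=> /and3P[_ cyc uq] /rot_to[k p kE]; exists p.
by rewrite -kE rot_uniq uq -[path _ _ _]/(cycle _ (o :: p)) -kE rot_cycle.
Qed.

(** The set is the cycle of one [sigma_jet]; the first node of the other jet lies outside it. *)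
Lemma mixed_jets_separating : mixed_jets Dm o -> exists Z, separating Z.
Proof.
have notin s c : sigma_jet Dm o s c -> o \notin c.
  by case/and3P=> _ _ /andP[]; rewrite mem_cat negb_or => /andP[].
have sep s c u : sigma_jet Dm o s c -> u \notin c -> arc Dm o u ->
    separating [set i in c].
  move=> jc uc ou; have /and3P[_ ec _] := jc.
  have side := elementary_cycle_side ec (notin _ _ jc).
  have sideZ i k : arc Dm i k -> i != o ->
      (i \in [set i in c]) = (k \in [set i in c]).
    by rewrite !inE; exact: side.
  have oZ : o \notin [set i in c] by rewrite inE (notin _ _ jc).
  split=> //; last by exists u; rewrite ?inE.
    apply/subsetP=> i; rewrite inE => ic; have [_ cyc _] := and3P ec.
    by have /wfD/andP[] := next_cycle cyc ic.
  exists (head o (s ++ c)); last exact: sigma_jet_head jc.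
  have [c0 _ _] := and3P ec; have hc : head o c \in c.
    by case: (c) c0 => // x c' _; rewrite mem_head.
  rewrite -(sigma_jet_side sideZ jc (x := head o c)) ?inE //.
  by rewrite mem_cat hc orbT.
case=> [[c [s [c' [oc jc']]]]|[s1 [c1 [s2 [c2 [j1 j2 diff]]]]]].
  have [p [pth uq]] := o_cycle_rot oc; have /and3P[_ ec' _] := jc'.
  have side := elementary_cycle_side ec' (notin _ _ jc').
  exists [set i in c']; apply: (sep s c' (head o p)) => //.
    suff: head o p \notin [set i in c'] by rewrite inE.
    apply: o_cycle_side pth uq; first by rewrite inE (notin _ _ jc').
    by move=> i k ik io; rewrite !inE; exact: side.
  by move: pth; case: (p) => [|v p'] /=; rewrite ?andbT // => /andP[].
have /and3P[_ e1 _] := j1; have /and3P[_ e2 _] := j2.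
exists [set i in c1]; apply: (sep s1 c1 (head o (s2 ++ c2))) => //; last first.
  exact: sigma_jet_head j2.
(* If the second jet started inside [c1], all its nodes would be in [c1], so the two cycles would
   meet. *)
apply/negP=> h1; apply: diff; apply: same_cycle_meet (notin _ _ j2) _ => //.
  exact: notin j1.
have side := elementary_cycle_side e1 (notin _ _ j1).
have c20 : head o c2 \in c2.
  by have [+ _ _] := and3P e2; case: (c2) => // x c _; rewrite mem_head.
have sideZ i k : arc Dm i k -> i != o ->
    (i \in [set i in c1]) = (k \in [set i in c1]).
  by rewrite !inE; exact: side.
have := sigma_jet_side sideZ j2 (x := head o c2).
by rewrite !inE mem_cat c20 orbT h1; apply.
Qed.

(** A set [W] lost by a retained set would itself be separating; the empty rest is what lets a jet
    enter it. *)
Lemma unseparated_irreducible : o \in nodes D -> ~ rest_nonempty Dm o ->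
  (forall Z, ~ separating Z) -> union_irreducible D.
Proof.
move=> oD nrest nsep; apply: union_irreducible_lost => // W W0 WD rW nvW.
have WsD := proper_sub WD; have critW := lost_critical wfD rW WsD nvW.
have oW : o \notin W.
  by apply/negP=> /critW[i _ /critical_not_branching]; rewrite eqxx.
have side i k : arc Dm i k -> i != o -> (i \in W) = (k \in W).
  move=> ki io; apply/idP/idP => [/critW[l lW]|].
    by case/criticalP=> _ _ /(_ _ ki) ->.
  apply: contraTT => iW; have /andP[kD iD] := wfD ki.
  have [l lU li] := rW.2 i k (introT setDP (conj iD iW)) ki.
  by move: lU; rewrite (arc_sole (ki : arc Dm i k) li io) inE => /andP[].
apply: (nsep W); split=> //.
- have [i iW] := set0Pn _ W0.
  (* As the rest is empty, [i] has access to some [k] accessible from [o]. The path from [i] cannot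
     leave [W], so [k] is in [W] and the path from [o] to [k] crosses into [W]. *)
  have /existsP[k /andP[]] : [exists k in nodes (sub_from Dm o),
      connect (arc Dm) i k].
    apply: contraT => ni; case: nrest; left; exists i.
    rewrite in_setD (subsetP WsD) // andbT; apply: contra ni.
    by rewrite inE => /andP[].
  rewrite inE => /andP[_ /connectP[p pth kE]] /connectP[q qth kE'].
  have kW : k \in W.
    elim: q i iW qth kE' => [|v q IH] i iW /=; first by move=> _ ->.
    case/andP=> iv qth; apply: IH => //.
    by rewrite -(side _ _ iv) //; apply: contraNneq oW => <-.
  (* By [side], an arc that enters [W] from outside starts at [o]. *)
  suff [v [w [vw vW wW]]] : exists v w, [/\ arc Dm v w, v \notin W & w \in W].
    exists w => //; have [<-//|/(side _ _ vw)] := eqVneq v o.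
    by rewrite wW (negPf vW).
  elim: p (o) oW pth kE => [|v p IH] u uW /=.
    by move=> _ kE; rewrite -kE kW in uW.
  case/andP=> uv pth kE; have [vW|/IH] := boolP (v \in W); first by exists u, v.
  exact.
- have [j oj|oj] := @pickP _ [pred i | arc Dm o i]; last first.
    by move: deg_o; rewrite /outdeg (eq_card oj) card0.
  have [k kU ok] := rW.2 o j (introT setDP (conj oD oW)) oj.
  by exists k => //; move: kU; rewrite inE => /andP[].
Qed.

End Branching.

(** * Extremals *)

Section Extremality.
Context {R : realType} {n : nat} (A : 'M[\bar R]_n) (x : 'cV[\bar R]_n).
Hypotheses (mA : mp_matrix A) (Xx : scrX A x).
Local Open Scope ereal_scope.
Implicit Types (y z : 'cV[\bar R]_n) (i j k : 'I_n) (U : {set 'I_n}).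

Let D := tangent_digraph A x.

Lemma mp_mulmx_ge y i j : A i j + y j ord0 <= mp_mulmx A y i ord0.
Proof. by rewrite mxE; exact: le_bigmax. Qed.

Lemma mp_mulmx_attained y i :
  exists j, mp_mulmx A y i ord0 = A i j + y j ord0.
Proof.
rewrite mxE; have [//||j _ ->] := @eq_bigmax _ _ _ -oo i xpredT
  (fun j => A i j + y j ord0); last by exists j.
by move=> j _; exact: leNye.
Qed.

Lemma supp_eqNy y i : mp_vector y -> (i \in supp y) = (y i ord0 != -oo).
Proof. by move=> my; rewrite inE fin_numE my andbT. Qed.

Lemma tangent_arcP j i :
  reflect [/\ i \in supp x, A i j + x j ord0 = mp_mulmx A x i ord0
            & mp_mulmx A x i ord0 = x i ord0] (arc D j i).
Proof.
rewrite /= [j \in _]inE.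
by apply: (iffP and3P) => -[iS /eqP-> /eqP->]; split.
Qed.

(** The source [j] is in the support because the finite component of [x] at [i] is the sum of
    [A i j] and the component at [j]. *)
Lemma tangent_arcs_in_nodes : arcs_in_nodes D.
Proof.
move=> j i /tangent_arcP[iS jE mE]; rewrite iS andbT.
by move: (iS); rewrite !inE -mE -jE fin_numD => /andP[].
Qed.

Lemma supp_neq0 : supp x != set0.
Proof.
case: Xx => mx _; apply: contra_not_neq => S0.
apply/matrixP=> i j; rewrite ord1 !mxE; apply/eqP; rewrite -[_ == _]negbK.
by rewrite -supp_eqNy // S0 inE.
Qed.

(** Without incoming arc, the row maximum is strictly above the component of [x]. A column [j]
    attaining it has finite terms, and [e] is the excess. *)
Lemma inactive_slack i : i \in supp x -> (forall j, ~~ arc D j i) ->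
  exists2 e : R, (0 < e)%R &
    forall y, (forall j, x j ord0 - e%:E <= y j ord0) ->
      x i ord0 <= mp_mulmx A y i ord0.
Proof.
case: Xx => mx lx _ iS narc; have [j jE] := mp_mulmx_attained x i.
have : x i ord0 < A i j + x j ord0.
  rewrite -jE lt_neqAle lx andbT; apply/negP=> /eqP xE.
  by move/negP: (narc j); apply; apply/tangent_arcP; rewrite -jE -xE.
move: iS (mA i j) (mx j); rewrite inE.
case xi: (x i ord0) => [r||] // _; case aij: (A i j) => [a||] // _;
  case xj: (x j ord0) => [b||] // _.
rewrite -EFinD lte_fin => rab; exists (a + b - r)%R; first by rewrite subr_gt0.
move=> y /(_ j); rewrite xj => /(leeD2l (A i j)) ley.
apply: le_trans (mp_mulmx_ge y i j); apply: le_trans ley.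
by rewrite aij -!EFinD lee_fin; lra.
Qed.

(** [lower] shifts by the same [e] everywhere, so the minimum of finitely many slacks is taken. *)
Lemma inactive_slack_uniform :
  exists2 e : R, (0 < e)%R &
    forall i, i \in supp x -> (forall j, ~~ arc D j i) ->
    forall y, (forall j, x j ord0 - e%:E <= y j ord0) ->
      x i ord0 <= mp_mulmx A y i ord0.
Proof.
suff [e e0 eP] : exists2 e : R, (0 < e)%R & forall i, i \in enum 'I_n ->
    i \in supp x -> (forall j, ~~ arc D j i) ->
    forall y, (forall j, x j ord0 - e%:E <= y j ord0) ->
      x i ord0 <= mp_mulmx A y i ord0.
  by exists e => // i; apply: eP; rewrite mem_enum.
elim: (enum 'I_n) => [|k s [e e0 eP]]; first by exists 1%R.
have weaken d d' y : (d' <= d)%R -> (forall j, x j ord0 - d'%:E <= y j ord0) ->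
    forall j, x j ord0 - d%:E <= y j ord0.
  by move=> dd yP j; apply: le_trans (yP j); apply: leeB => //; rewrite lee_fin.
have [/andP[kS /forallP narc]|active] :=
    boolP ((k \in supp x) && [forall j, ~~ arc D j k]); last first.
  exists e => // i; rewrite inE => /predU1P[->|/eP//] kS narc.
  by move: active; rewrite kS => /forallP.
have [d d0 dP] := inactive_slack kS narc.
exists (Num.min d e); first by rewrite lt_min d0.
move=> i + iS ni y yP; rewrite inE => /predU1P[->|si].
  by apply: dP; apply: weaken yP; rewrite ge_min lexx.
by apply: (eP i) => //; apply: weaken yP; rewrite ge_min lexx orbT.
Qed.

Definition lower (e : R) U : 'cV[\bar R]_n :=
  \col_i if i \in U then x i ord0 else x i ord0 - e%:E.

(** A node without incoming arc is covered by the slack. One in [U] with an incoming arc has a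
    predecessor that is not lowered. One outside [U] may lose [e], as its own component does. *)
Lemma lower_scrX (e : R) U : (0 < e)%R ->
  (forall i, i \in supp x -> (forall j, ~~ arc D j i) ->
    forall y, (forall j, x j ord0 - e%:E <= y j ord0) ->
      x i ord0 <= mp_mulmx A y i ord0) ->
  retained D U -> scrX A (lower e U).
Proof.
move=> e0 slack [US rU]; case: (Xx) => mx lx _.
have lowx i : lower e U i ord0 <= x i ord0.
  by rewrite mxE; case: ifP => // _; rewrite geeDl // lee_fin oppr_le0 ltW.
have xlow i : x i ord0 - e%:E <= lower e U i ord0.
  by rewrite mxE; case: ifP => // _; rewrite geeDl // lee_fin oppr_le0 ltW.
split=> [i|i|low0].
- by apply: contra (mx i) => /eqP lE; rewrite -leye_eq -lE.
- have [iS|] := boolP (i \in supp x); last first.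
    rewrite supp_eqNy // negbK => /eqP xi; apply: le_trans (lowx i) _.
    by rewrite xi leNye.
  have [/forallP narc|] := boolP [forall j, ~~ arc D j i].
    exact: le_trans (lowx i) (slack i iS narc _ xlow).
  rewrite -negb_exists negbK => /existsP[j ji].
  have [iU|iU] := boolP (i \in U).
    have [k kU /tangent_arcP[_ kE mE]] := rU i j iU ji.
    apply: le_trans (mp_mulmx_ge _ i k).
    by rewrite !mxE iU kU kE mE.
  have /tangent_arcP[_ jE mE] := ji.
  apply: le_trans (mp_mulmx_ge _ i j).
  apply: le_trans (leeD2l (A i j) (xlow j)).
  by rewrite addeA jE mE mxE (negPf iU).
- have [i iS] := set0Pn _ supp_neq0.
  have := congr1 (fun y : 'cV_n => y i ord0) low0; rewrite !mxE.
  by move: iS; rewrite inE; case: (x i ord0) => [r||] //; case: ifP.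
Qed.

(** Let [k] attain row [i] for [y]. Where [y] and [x] agree at a node [i] with an incoming arc,
    [x_i <= a_ik + y_k <= a_ik + x_k <= x_i]; equality makes [k] a predecessor of [i], and
    cancelling the finite [a_ik] gives agreement at [k]. *)
Lemma agreement_retained y z : scrX' A y -> x = mp_add y z ->
  retained D [set i in supp x | y i ord0 == x i ord0].
Proof.
move=> Xy xE.
have yx i : y i ord0 <= x i ord0 by rewrite xE mxE le_max lexx.
have ly i : y i ord0 <= mp_mulmx A y i ord0.
  by case: Xy => [[]//|->]; rewrite mxE leNye.
split=> [|i j]; first by apply/subsetP=> i; rewrite inE => /andP[].
rewrite inE => /andP[iS /eqP yi] /tangent_arcP[_ _ mE].
have [k kE] := mp_mulmx_attained y i.
have xi_le : x i ord0 <= A i k + y k ord0 by rewrite -kE -yi.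
have le_xi : A i k + x k ord0 <= x i ord0 by rewrite -mE mp_mulmx_ge.
have eq_yx : A i k + y k ord0 = x i ord0.
  apply/eqP; rewrite eq_le xi_le andbT; apply: le_trans le_xi.
  exact: leeD2l.
have eq_x : A i k + x k ord0 = x i ord0.
  apply/eqP; rewrite eq_le le_xi /=; apply: le_trans xi_le _; exact: leeD2l.
have ki : arc D k i by apply/tangent_arcP; rewrite eq_x mE.
exists k => //; rewrite inE; have /andP[-> _] := tangent_arcs_in_nodes ki.
have aik : A i k \is a fin_num.
  by move: iS; rewrite inE -eq_x fin_numD => /andP[].
rewrite eq_le -(leeD2lE (y k ord0) _ aik) -(leeD2lE (x k ord0) _ aik).
by rewrite eq_yx eq_x lexx.
Qed.

Lemma extremal_union_irreducible : extremal (scrX' A) x <-> union_irreducible D.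
Proof.
case: (Xx) => mx _ _; split=> [[_ ext] U1 U2 r1 r2 U12|irr].
  have [e e0 slack] := inactive_slack_uniform.
  (* Lowering changes every finite component outside [U], as [e] is positive. *)
  have lowE U : retained D U -> x = lower e U -> U = nodes D.
    move=> [US _] xE; apply/eqP; rewrite eqEsubset US; apply/subsetP=> i iS.
    apply: contraT => iU; move: (iS); rewrite inE => fxi.
    have := congr1 (fun y : 'cV_n => y i ord0) xE; rewrite mxE (negPf iU).
    by move: fxi; case: (x i ord0) => [r||] // _; rewrite -EFinB => -[]; lra.
  have [|||/(lowE _ r1)|/(lowE _ r2)] := ext (lower e U1) (lower e U2).
  - by left; exact: lower_scrX.
  - by left; exact: lower_scrX.
  - apply/matrixP=> i j; rewrite ord1 !mxE.
    have xe : x i ord0 - e%:E <= x i ord0.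
      by rewrite geeDl // lee_fin oppr_le0 ltW.
    have [iU|iU1] := boolP (i \in U1).
      by case: ifP => _; rewrite ?maxxx //; rewrite max_l.
    have [iU2|iU2] := boolP (i \in U2); first by rewrite max_r.
    have : i \notin supp x by rewrite -[supp x]/(nodes D) -U12 inE negb_or iU1.
    by rewrite supp_eqNy // negbK => /eqP->; rewrite maxxx.
  - by left.
  - by right.
split; [by left|move=> y z Xy Xz xE].
have xE' : x = mp_add z y.
  by rewrite xE; apply/matrixP=> i j; rewrite !mxE maxC.
(* Outside the support [x] is [-oo], and so is [u], being at most [x]. *)
have agree u v : x = mp_add u v ->
    [set i in supp x | u i ord0 == x i ord0] = nodes D -> x = u.
  move=> xuv uE; apply/matrixP=> i j; rewrite ord1.
  have [iS|] := boolP (i \in supp x).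
    by move: (iS); rewrite -[supp x]/(nodes D) -uE inE => /andP[_ /eqP->].
  rewrite supp_eqNy // negbK => /eqP xi; rewrite xi; apply/esym/eqP.
  by rewrite -leeNy_eq -xi xuv mxE le_max lexx.
have [|/(agree _ _ xE)|/(agree _ _ xE')] :=
    irr _ _ (agreement_retained Xy xE) (agreement_retained Xz xE').
- apply/setP=> i; rewrite !inE -andb_orr andb_idr // => _.
  by rewrite xE mxE; case: leP => _; rewrite eqxx ?orbT.
- by left.
- by right.
Qed.

End Extremality.

(** * Results and costs of programs *)

Section Semantics.
Context {n : nat} {V : Type} (add : V -> V -> V) (leq : V -> V -> bool).
Local Notation farray := (@farray n).
Local Notation prog := (prog n V farray).
Local Notation node := 'I_n.
Local Notation result := (result add leq).
Local Notation cost := (cost add leq).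
Implicit Types (l : seq node) (u v w : node).

Lemma result_bind S T (p : prog S) (f : S -> prog T) :
  result (bind p f) = result (f (result p)).
Proof. by elim: p => [//|U e k IH] /=; rewrite IH. Qed.

Lemma cost_bind S T (p : prog S) (f : S -> prog T) :
  cost (bind p f) = cost p + cost (f (result p)).
Proof. by elim: p => [//|U e k IH] /=; rewrite IH addnA. Qed.

Lemma result_fold_nodes S (f : S -> node -> prog S) st l :
  result (fold_nodes f st l) = foldl (fun s u => result (f s u)) st l.
Proof. by elim: l st => [//|u l IH] st /=; rewrite result_bind IH. Qed.

(** The extra unit per node is the [Visit]. *)
Lemma cost_fold_nodes S (f : S -> node -> prog S) k st l :
  (forall s u, cost (f s u) <= k) ->
  cost (fold_nodes f st l) <= k.+1 * size l.
Proof.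
move=> fk; elim: l st => [//|u l IH] st /=; rewrite cost_bind.
by have := IH (result (f st u)); have := fk st u; lia.
Qed.

Lemma result_all_nodes (p : node -> prog bool) l :
  result (all_nodes p l) = all (fun u => result (p u)) l.
Proof.
by elim: l => [//|u l IH] /=; rewrite result_bind; case: (result (p u)).
Qed.

Lemma cost_all_nodes (p : node -> prog bool) k l :
  {in l, forall u, cost (p u) <= k} ->
  cost (all_nodes p l) <= k.+1 * size l.
Proof.
elim: l => [//|u l IH] pk /=; rewrite cost_bind.
have {}IH := IH (sub_in1 (mem_behead (s := u :: l)) pk).
by have := pk u (mem_head u l); case: (result (p u)) => /=; lia.
Qed.

Lemma result_find_node (p : node -> prog bool) l :
  result (find_node p l) = ohead [seq u <- l | result (p u)].
Proof.
by elim: l => [//|u l IH] /=; rewrite result_bind; case: (result (p u)).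
Qed.

Lemma cost_find_node (p : node -> prog bool) k l :
  (forall u, cost (p u) <= k) -> cost (find_node p l) <= k.+1 * size l.
Proof.
move=> pk; elim: l => [//|u l IH] /=; rewrite cost_bind.
by have := pk u; case: (result (p u)) => /=; lia.
Qed.

Lemma result_filter_nodes (p : node -> prog bool) l :
  result (filter_nodes p l) = rev [seq u <- l | result (p u)].
Proof.
rewrite /filter_nodes result_fold_nodes /rev; move: [::].
elim: l => [//|u l IH] s /=; rewrite IH result_bind.
by case: (result (p u)).
Qed.

Lemma cost_filter_nodes (p : node -> prog bool) k l :
  (forall u, cost (p u) <= k) -> cost (filter_nodes p l) <= k.+1 * size l.
Proof.
by move=> pk; apply: cost_fold_nodes => s u; rewrite cost_bind addn0.
Qed.

Lemma result_several_nodes (p : node -> prog bool) seen l :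
  result (several_nodes p seen l) =
    (1 < count (fun u => result (p u)) l + seen).
Proof.
elim: l seen => [[]//|u l IH] seen /=; rewrite result_bind.
by case: (result (p u)); case: seen => /=; rewrite ?IH //; lia.
Qed.

Lemma cost_several_nodes (p : node -> prog bool) k seen l :
  {in l, forall u, cost (p u) <= k} ->
  cost (several_nodes p seen l) <= k.+1 * size l.
Proof.
elim: l seen => [//|u l IH] seen pk /=; rewrite cost_bind.
have {}IH s := IH s (sub_in1 (mem_behead (s := u :: l)) pk).
have := IH (result (p u) || seen); have := pk u (mem_head u l).
by case: (_ && _) => /=; lia.
Qed.

Lemma result_at_least_two l : result (at_least_two l) = (1 < size l).
Proof. by case: l => [|u [|w l]]. Qed.

Lemma cost_at_least_two l : cost (at_least_two l) <= 2.
Proof. by case: l => [|u [|w l]]. Qed.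

(** The invariant of a search state: a node is listed only at the moment it is marked, hence at most
    once. *)
Definition closed_marks (st : seq node * farray bool) : Prop :=
  uniq st.1 /\ forall u, u \in st.1 -> st.2 u.

Lemma result_touch st v (st' := result (touch st v)) : closed_marks st ->
  [/\ uniq st'.1, forall u, st'.2 u = st.2 u || (u == v)
    & forall u, (u \in st'.1) = (u \in st.1) || ~~ st.2 u && (u == v)].
Proof.
case: st @st' => todo marks /= [ut sub]; case mv: (marks v) => /=.
  by split=> // u; have [->|_] := eqVneq u v; rewrite ?mv ?andbF ?orbF.
split=> [|u|u].
- by rewrite ut andbT; apply/negP=> /sub /=; rewrite mv.
- by case: eqVneq => _; rewrite ?orbT ?orbF.
- by rewrite inE orbC; case: eqVneq => [->|_]; rewrite ?mv ?andbF.
Qed.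

Lemma result_touch_all st l (st' := result (fold_nodes touch st l)) :
  closed_marks st ->
  [/\ uniq st'.1, forall u, st'.2 u = st.2 u || (u \in l)
    & forall u, (u \in st'.1) = (u \in st.1) || ~~ st.2 u && (u \in l)].
Proof.
rewrite {}/st' result_fold_nodes.
elim: l st => [|v l IH] st [ut sub] /=.
  by split=> // u; rewrite ?andbF orbF.
have [ut' m't t't] := result_touch v (conj ut sub).
have [|ut'' m'' t''] := IH (result (touch st v)).
  by split=> // u; rewrite t't m't => /orP[/sub ->|/andP[_ ->]]; rewrite ?orbT.
split=> // u; first by rewrite m'' m't inE orbA.
rewrite t'' t't m't inE negb_or.
by case: (_ \in st.1); case: (st.2 u) => //=; case: eqVneq.
Qed.

Lemma cost_touch_all st l : cost (fold_nodes touch st l) <= 3 * size l.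
Proof.
by apply: cost_fold_nodes => -[todo marks] v /=; case: (marks v).
Qed.

(** One array gives a directed search; [outs] and [ins] together ignore the directions. *)
Definition neighbours (adjs : seq (farray (seq node))) u : seq node :=
  flatten [seq adj u | adj : farray (seq node) <- adjs].

Lemma result_expand adjs u st (st' := result (expand adjs u st)) :
  closed_marks st ->
  [/\ uniq st'.1, forall v, st'.2 v = st.2 v || (v \in neighbours adjs u)
    & forall v, (v \in st'.1) =
        (v \in st.1) || ~~ st.2 v && (v \in neighbours adjs u)].
Proof.
rewrite {}/st'; elim: adjs st => [|adj adjs IH] st [ut sub] /=.
  by split=> // v; rewrite ?andbF orbF.
rewrite result_bind.
have [ut' m't t't] := result_touch_all (adj u) (conj ut sub).
have [|ut'' m'' t''] := IH (result (fold_nodes touch st (adj u))).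
  by split=> // v; rewrite t't m't => /orP[/sub ->|/andP[_ ->]]; rewrite ?orbT.
split=> // v; first by rewrite m'' m't mem_cat orbA.
rewrite t'' t't m't mem_cat negb_or.
by case: (_ \in st.1); case: (st.2 v) => //=; case: (_ \in adj u).
Qed.

Lemma cost_expand adjs u st k :
  (forall adj, List.In adj adjs -> size (adj u) <= k) ->
  cost (expand adjs u st) <= (3 * k).+1 * size adjs.
Proof.
elim: adjs st => [//|adj adjs IH] st adjk /=; rewrite cost_bind.
have := IH (result (fold_nodes touch st (adj u)))
  (fun a aI => adjk a (or_intror aI)).
by have := cost_touch_all st (adj u); have := adjk adj (or_introl erefl); lia.
Qed.

Section Search.
Context (adjs : seq (farray (seq node))) (starts : seq node).
Let e : rel node := fun u v => v \in neighbours adjs u.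

(* The processed nodes are the marked ones outside [todo]; each iteration
   processes one more, so [n] iterations are enough. *)
Lemma result_search fuel todo (marks : farray bool) :
  uniq todo -> (forall u, u \in todo -> marks u) ->
  (forall u, u \in starts -> marks u) ->
  (forall v, marks v -> [exists s in starts, connect e s v]) ->
  (forall u v, marks u -> u \notin todo -> e u v -> marks v) ->
  n <= fuel + #|[pred u | marks u & u \notin todo]| ->
  forall v, result (search fuel adjs todo marks) v =
            [exists s in starts, connect e s v].
Proof.
have final (m : farray bool) : (forall u, u \in starts -> m u) ->
    (forall v, m v -> [exists s in starts, connect e s v]) ->
    (forall u v, m u -> e u v -> m v) ->
    forall v, m v = [exists s in starts, connect e s v].
  move=> sm mreach closed v; apply/idP/idP => [|/existsP[s /andP[ss]]].
    exact: mreach.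
  case/connectP=> p pth ->.
  elim: p (s) (sm s ss) pth => [//|w p IH] {ss}t ms /=.
  by case/andP=> /(closed _ _ ms) mw; exact: IH.
elim: fuel todo marks => [|fuel IH] todo marks ut tm sm mreach closed fuelP.
  apply: final => // u v mu; apply: closed => //.
  (* Without fuel, the count says that all [n] nodes have been processed. *)
  have /subset_cardP/(_ (subset_predT _)) :
      #|[pred u | marks u & u \notin todo]| = #|'I_n|.
    by apply/eqP; rewrite eqn_leq max_card card_ord.
  by move=> /(_ u); rewrite !inE => /andP[].
case: todo ut tm closed fuelP => [|u todo] ut tm closed fuelP /=.
  by apply: final => // w v mw; exact: closed.
rewrite result_bind.
have [uT ut'] := andP ut.
have cm : closed_marks (todo, marks).
  by split=> //= v vt; apply: tm; rewrite inE vt orbT.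
have [/= ut2 m2 t2] := result_expand adjs u cm.
set st := result _ in ut2 m2 t2 *.
have mu : marks u by apply: tm; rewrite mem_head.
apply: IH => //.
- by move=> v; rewrite t2 m2 => /orP[/cm.2/= ->|/andP[_ ->]]; rewrite ?orbT.
- by move=> v vs; rewrite m2 sm.
- move=> v; rewrite m2 => /orP[|uv]; first exact: mreach.
  have /existsP[s /andP[ss su]] := mreach u mu; apply/existsP; exists s.
  by rewrite ss; exact: connect_trans su (connect1 uv).
- move=> w v; rewrite !m2 t2 negb_or negb_and negbK => /orP[mw|uw].
    rewrite mw /= andbT => wt wv; have [wu|wu] := eqVneq w u.
      by apply/orP; right; rewrite -wu.
    by rewrite (closed w) // inE negb_or wu.
  rewrite uw orbF => /andP[wt mw] wv; have [wu|wu] := eqVneq w u.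
    by apply/orP; right; rewrite -wu.
  by rewrite (closed w) // inE negb_or wu.
- apply: leq_trans fuelP _.
  (* The processed nodes gain [u]. None is lost, since only nodes unmarked so far join the list. *)
  rewrite addSnnS leq_add2l proper_card //; apply/properP; split.
    apply/subsetP=> v; rewrite !inE m2 t2 negb_or => /andP[mv].
    by rewrite mv negb_or => /andP[_ ->].
  by exists u; rewrite !inE ?m2 ?t2 mu ?eqxx //= orbF.
Qed.

Lemma result_reach v :
  result (reach adjs starts) v = [exists s in starts, connect e s v].
Proof.
rewrite /= result_bind.
have [//|ut m t] := @result_touch_all ([::], fun=> false) starts.
apply: result_search => //.
- by move=> u; rewrite m t.
- by move=> u us; rewrite m us.
- by move=> u; rewrite m /= => us; apply/existsP; exists u; rewrite us connect0.
- by move=> u w; rewrite m t => /= ->.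
- exact: leq_addr.
Qed.

Lemma cost_search fuel todo marks k :
  (forall adj u, List.In adj adjs -> size (adj u) <= k) ->
  cost (search fuel adjs todo marks) <= ((3 * k).+1 * size adjs).+1 * fuel.
Proof.
move=> adjk; elim: fuel todo marks => [//|fuel IH] [//|u todo] marks /=.
rewrite cost_bind.
rewrite mulnS addnA leq_add ?IH // add1n ltnS.
by apply: cost_expand => adj; exact: adjk.
Qed.

Lemma cost_reach k : (forall adj u, List.In adj adjs -> size (adj u) <= k) ->
  cost (reach adjs starts) <=
    n + 3 * size starts + ((3 * k).+1 * size adjs).+1 * n.
Proof.
move=> adjk; rewrite /= cost_bind -addnA leq_add2l leq_add //.
  exact: cost_touch_all.
exact: cost_search.
Qed.

End Search.

End Semantics.

(** * Programs on a represented digraph *)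

Section Representation.
Context {n : nat} {V : Type} (add : V -> V -> V) (leq : V -> V -> bool).
Local Notation farray := (@farray n).
Local Notation prog := (prog n V farray).
Local Notation node := 'I_n.
Local Notation result := (result add leq).
Local Notation cost := (cost add leq).
Implicit Types (D : digraph node) (L : adjacency (n := n) (arr := farray)).
Implicit Types (u v w : node).

(** Without repetitions the lengths of the lists are degrees, as [at_least_two] and the cost bounds
    require. *)
Definition represents D L : Prop :=
  [/\ uniq (node_list L) /\ node_list L =i nodes D,
      forall u, uniq (outs L u) /\ forall v, (v \in outs L u) = arc D u v
    & forall v, uniq (ins L v) /\ forall u, (u \in ins L v) = arc D u v].

Lemma represents_reversed D L :
  represents D L -> represents (swap_arcs D) (reversed L).
Proof. by case=> nodesL outsL insL; split. Qed.

Lemma size_uniq_nodes (l : seq node) : uniq l -> size l <= n.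
Proof.
by move=> /card_uniqP <-; rewrite -[X in _ <= X]card_ord max_card.
Qed.

Lemma result_all_marked (marks : farray bool) (l : seq node) :
  reflect {in l, forall v, marks v}
          (result (all_nodes (fun v => op (Get marks v)) l)).
Proof. by rewrite result_all_nodes; exact: allP. Qed.

Section Represented.
Context (D : digraph node) (L : adjacency (n := n) (arr := farray)).
Hypothesis repL : represents D L.

Lemma mem_node_list : node_list L =i nodes D.
Proof. by have [[]] := repL. Qed.

Lemma mem_outs u v : (v \in outs L u) = arc D u v.
Proof. by have [_ /(_ u)[_ ->]] := repL. Qed.

Lemma mem_ins u v : (u \in ins L v) = arc D u v.
Proof. by have [_ _ /(_ v)[_ ->]] := repL. Qed.

Lemma size_node_list : size (node_list L) <= n.
Proof. by have [[/size_uniq_nodes]] := repL. Qed.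

Lemma size_outs u : size (outs L u) = outdeg D u.
Proof.
have [_ /(_ u)[uq _] _] := repL; rewrite -(card_uniqP uq).
by apply: eq_card => v; rewrite mem_outs.
Qed.

Lemma size_ins v : size (ins L v) = indeg D v.
Proof.
have [_ _ /(_ v)[uq _]] := repL; rewrite -(card_uniqP uq).
by apply: eq_card => u; rewrite mem_ins.
Qed.

Lemma size_outs_le u : size (outs L u) <= n.
Proof. by rewrite size_outs -[X in _ <= X]card_ord max_card. Qed.

Lemma size_ins_le v : size (ins L v) <= n.
Proof. by rewrite size_ins -[X in _ <= X]card_ord max_card. Qed.

Lemma indeg_gt1 u k : arc D u k ->
  reflect (exists2 j, j != u & arc D j k) (1 < indeg D k).
Proof.
move=> uk; rewrite /indeg (cardD1 u) inE uk -[_ + _]/(_.+1) ltnS.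
apply: (iffP card_gt0P) => -[j]; first by rewrite !inE => /andP[]; exists j.
by exists j; rewrite !inE; apply/andP.
Qed.

Lemma result_is_variable u :
  reflect (forall k, arc D u k -> k != u -> exists2 j, j != u & arc D j k)
          (result (is_variable L u)).
Proof.
rewrite /= result_all_nodes.
apply: (iffP allP) => [vu k uk ku|vu k].
  have := vu k; rewrite mem_outs => /(_ uk) /=; rewrite (negPf ku) /=.
  by rewrite result_at_least_two size_ins => /(indeg_gt1 uk).
rewrite mem_outs => uk /=; case: eqVneq => //= ku.
by rewrite result_at_least_two size_ins; apply/(indeg_gt1 uk)/vu.
Qed.

Lemma result_several_variable :
  reflect (several_variable D)
          (result (several_nodes (is_variable L) false (node_list L))).
Proof.
rewrite result_several_nodes addn0.
have varP u : u \in nodes D -> result (is_variable L u) <-> variable D u.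
  move=> uD; split=> [/result_is_variable vu|[_ [lo|vu]]].
  - by split=> //; right.
  - by apply/result_is_variable => k /lo ->; rewrite eqxx.
  - exact/result_is_variable.
have [[uqL memL] _ _] := repL.
rewrite -size_filter -(card_uniqP (filter_uniq _ uqL)).
apply: (iffP card_gt1P) => -[u [v []]].
  rewrite !mem_filter !memL => /andP[/varP vu uD] /andP[/varP vv vD] uv.
  by exists u, v; split; [|exact: vu|exact: vv].
move=> uv vu vv; exists u, v; split=> //.
  by rewrite mem_filter memL vu.1 andbT; apply/varP => //; exact: vu.1.
by rewrite mem_filter memL vv.1 andbT; apply/varP => //; exact: vv.1.
Qed.

(** An arc costs at most five operations: its visit, [Same_node], [Get] and two visits in
    [at_least_two]. A node adds a visit and a [Get]. *)
Lemma cost_several_variable :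
  cost (several_nodes (is_variable L) false (node_list L)) <= (5 * n).+2 * n.
Proof.
apply: leq_trans (leq_mul (leqnn _) size_node_list).
apply: cost_several_nodes => u _; rewrite /= add1n ltnS.
apply: leq_trans (leq_mul (leqnn _) (size_outs_le u)).
apply: cost_all_nodes => k _ /=; case: eqP => //= _.
by have := cost_at_least_two add leq (ins L k); lia.
Qed.

Lemma result_find_branching :
  match result (find_node (branching L) (node_list L)) with
  | Some o => o \in nodes D /\ 1 < outdeg D o
  | None => forall u, u \in nodes D -> outdeg D u <= 1
  end.
Proof.
rewrite result_find_node; set l := [seq _ <- _ | _].
have memE u : (u \in l) = (1 < outdeg D u) && (u \in nodes D).
  by rewrite mem_filter mem_node_list /= result_at_least_two size_outs.
case lE: l memE => [|o l'] /= memE.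
  move=> u uD; have := memE u.
  by rewrite uD andbT => /esym/negbT; rewrite -leqNgt.
by have := memE o; rewrite mem_head => /esym/andP[].
Qed.

Lemma cost_find_branching :
  cost (find_node (branching L) (node_list L)) <= 4 * n.
Proof.
apply: leq_trans (leq_mul (leqnn _) size_node_list).
apply: cost_find_node => u /=.
by have := cost_at_least_two add leq (outs L u); lia.
Qed.

Hypothesis wfD : arcs_in_nodes D.

(** The nodes connected to [u] form an isolated set, proper as soon as one node is missed.
    Conversely, membership in an isolated set is constant along [e]. *)
Lemma result_no_isolated_subset : nodes D != set0 ->
  reflect (exists W, [/\ W != set0, W \proper nodes D & isolated D W])
          (~~ result (no_isolated_subset L)).
Proof.
move=> D0; rewrite /no_isolated_subset.
case lE: (node_list L) => [|u l].
  suff D0' : nodes D = set0 by rewrite D0' eqxx in D0.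
  by apply/setP=> v; rewrite -mem_node_list lE inE.
have uD : u \in nodes D by rewrite -mem_node_list lE mem_head.
rewrite result_bind -lE.
pose e := fun v w => w \in neighbours [:: outs L; ins L] v.
have eE v w : e v w = arc D v w || arc D w v.
  by rewrite /e /neighbours /= cats0 mem_cat mem_outs mem_ins.
have eD v w : e v w -> (v \in nodes D) * (w \in nodes D).
  by rewrite eE => /orP[]/wfD/andP[-> ->].
have markE v : result (reach [:: outs L; ins L] [:: u]) v = connect e u v.
  rewrite result_reach; apply/existsP/idP => [[s /andP[]]|uv].
    by rewrite inE => /eqP->.
  by exists u; rewrite inE eqxx.
set all_reached := Defs.result _ _ (all_nodes _ _).
have reachP : reflect {in nodes D, forall v, connect e u v} all_reached.
  apply: (iffP (result_all_marked _ _)) => H v.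
    by rewrite -mem_node_list -markE; exact: H.
  by rewrite mem_node_list markE; exact: H.
apply: (iffP idP) => [nall|[W [W0 WD [_ iso]]]]; last first.
  apply/negP=> /reachP H.
  have sideE v w : e v w -> (v \in W) = (w \in W).
    move=> vw; have [vD wD] := eD _ _ vw; move: vw; rewrite eE.
    have [vW|vW] := boolP (v \in W); have [wW|wW] := boolP (w \in W) => //.
      have wDW : w \in nodes D :\: W by rewrite in_setD wW.
      by have /andP[/negPf-> /negPf->] := iso v w vW wDW.
    have vDW : v \in nodes D :\: W by rewrite in_setD vW.
    by have /andP[/negPf-> /negPf->] := iso w v wW vDW.
  have side v : v \in nodes D -> (v \in W) = (u \in W).
    move=> /H/connectP[p pth ->]; elim: p (u) pth => [//|w p IH] t /=.
    by case/andP=> /sideE-> /IH.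
  have [v vW] := set0Pn _ W0; have [WsD [w wD wW]] := properP WD.
  by case/negP: wW; rewrite (side w wD) -(side v) // (subsetP WsD).
have [v vD nuv] : exists2 v, v \in nodes D & ~~ connect e u v.
  move: nall; rewrite /all_reached result_all_nodes => /allPn[v].
  rewrite mem_node_list => vD.
  rewrite -[X in ~~ X]/(result (reach [:: outs L; ins L] [:: u]) v) markE.
  by exists v.
exists [set v in nodes D | connect e u v]; split.
- by apply/set0Pn; exists u; rewrite inE uD connect0.
- apply/properP; split; last by exists v; rewrite // inE vD.
  by apply/subsetP=> w; rewrite inE => /andP[].
split=> [|i j]; first by apply/subsetP=> w; rewrite inE => /andP[].
rewrite !inE => /andP[_ ui] /andP[+ jD]; rewrite jD /= -negb_or -eE.
by apply: contra => ij; exact: connect_trans ui (connect1 ij).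
Qed.

Lemma cost_no_isolated_subset :
  cost (no_isolated_subset L) <= n + 3 + ((3 * n).+1 * 2).+1 * n + 2 * n.
Proof.
rewrite /no_isolated_subset; case lE: (node_list L) => [//|u l].
rewrite cost_bind leq_add //.
  apply: cost_reach => adj v /= [<-|[<-|//]]; first exact: size_outs_le.
  exact: size_ins_le.
apply: leq_trans (leq_mul (leqnn _) size_node_list).
by rewrite lE; exact: cost_all_nodes.
Qed.

Lemma result_rest_empty o : o \in nodes D ->
  reflect (rest_nonempty D o) (~~ result (rest_empty L o)).
Proof.
move=> oD; rewrite /rest_empty result_bind.
set from_o := Defs.result _ _ (reach _ _).
rewrite result_bind result_filter_nodes; set l := rev _; rewrite result_bind.
have connE u v : connect (fun u v => v \in neighbours [:: outs L] u) u v =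
    connect (arc D) u v.
  by apply: eq_connect => {u v} u v; rewrite /neighbours /= cats0 mem_outs.
have connE' u v : connect (fun u v => v \in neighbours [:: ins L] u) u v =
    connect (arc D) v u.
  transitivity (connect [rel x y | arc D y x] u v); last exact: connect_rev.
  by apply: eq_connect => {u v} u v; rewrite /neighbours /= cats0 mem_ins.
have memE v : (v \in l) = (v \in nodes (sub_from D o)).
  rewrite mem_rev mem_filter mem_node_list inE andbC; congr (_ && _).
  rewrite -[result _]/(from_o v) /from_o result_reach.
  apply/existsP/idP => [[s]|ov].
    by rewrite inE connE => /andP[/eqP->].
  by exists o; rewrite inE eqxx connE.
have closE v : v \in nodes D ->
    result (reach [:: ins L] l) v = (v \in nodes (sub_closure D o)).
  move=> vD; rewrite result_reach inE vD /=.
  by apply: eq_existsb => s; rewrite memE connE'.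
rewrite result_all_nodes; apply: (iffP allPn) => [[v]|rest].
  rewrite mem_node_list => vD.
  rewrite -[X in ~~ X]/(result (reach [:: ins L] l) v) closE // => vC.
  by left; exists v; rewrite in_setD vC.
have [v vD vC] : exists2 v, v \in nodes D & v \notin nodes (sub_closure D o).
  case: rest => [[v]|[v [w [vw]]]].
    by rewrite in_setD => /andP[vC vD]; exists v.
  rewrite -[arc (sub_closure _ _) _ _]/((v \in _) && arc D v w) vw andbT.
  by exists v => //; case/andP: (wfD vw).
exists v; rewrite ?mem_node_list //.
by rewrite -[X in ~~ X]/(result (reach [:: ins L] l) v) closE.
Qed.

Lemma cost_rest_empty o :
  cost (rest_empty L o) <=
    n + 3 + ((3 * n).+1 * 1).+1 * n +
    (2 * n + (n + 3 * n + ((3 * n).+1 * 1).+1 * n + 2 * n)).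
Proof.
rewrite /rest_empty cost_bind leq_add //.
  by apply: cost_reach => adj v /= [<-|//]; exact: size_outs_le.
rewrite cost_bind leq_add //.
  apply: leq_trans (leq_mul (leqnn _) size_node_list).
  exact: cost_filter_nodes.
rewrite cost_bind leq_add //; last first.
  apply: leq_trans (leq_mul (leqnn _) size_node_list).
  exact: cost_all_nodes.
set l := Defs.result _ _ (filter_nodes _ _).
have ln : size l <= n.
  rewrite /l result_filter_nodes size_rev size_filter.
  exact: leq_trans (count_size _ _) size_node_list.
apply: leq_trans (cost_reach add leq (k := n) _ _) _.
  by move=> adj v /= [<-|//]; exact: size_ins_le.
by rewrite leq_add2r leq_add2l leq_mul2l ln.
Qed.

Lemma cost_follow o fuel u (marks : farray bool) :
  cost (follow fuel L o u marks) <= 5 * fuel.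
Proof.
elim: fuel u marks => [//|fuel IH] u marks /=.
case: (u == o) => /=; first lia.
case: (marks u) => /=; first lia.
case: (outs L u) => [|w l] /=; first lia.
by have := IH w (fun v => if v == u then true else marks v); lia.
Qed.

Lemma cost_jet o u : cost (jet L o u) <= 6 * n.
Proof. by rewrite /=; have := cost_follow o n u (fun=> false); lia. Qed.

Lemma cost_mark_cycle fuel u (marks : farray bool) :
  cost (mark_cycle fuel L u marks) <= 4 * fuel.
Proof.
elim: fuel u marks => [//|fuel IH] u marks /=.
case: (marks u) => /=; first lia.
case: (outs L u) => [|w l] /=; first lia.
by have := IH w (fun v => if v == u then true else marks v); lia.
Qed.

(** The term [11 * n] is made of [6 * n] for the first jet, [n] for the new array and [4 * n] for
    marking its cycle. Each further jet adds a visit and a lookup to its own [6 * n]. *)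
Lemma cost_jets_agree o :
  cost (jets_agree L o) <= 2 + 11 * n + (6 * n).+2 * n.
Proof.
rewrite /jets_agree cost_bind [result (op _)]/= [cost (op _)]/=.
have := size_outs_le o; case: (outs L o) => [|u l] ln; first by rewrite /=; lia.
rewrite cost_bind [cost (op _)]/= cost_bind.
have mulle k : k <= (6 * n).+2 -> k * size l <= (6 * n).+2 * n.
  by move=> kn; apply: leq_mul => //; exact: leq_trans ln.
have := cost_jet o u.
case: (result (jet L o u)) => [w|].
  rewrite cost_bind [cost (op _)]/= [result (op _)]/= cost_bind.
  have := cost_mark_cycle n w (fun=> false).
set sigma := Defs.result _ _ _.
  set rest := cost (all_nodes _ _).
  suff : rest <= (6 * n).+2 * n by lia.
  apply: leq_trans (mulle _ (leqnn _)); apply: cost_all_nodes => v _.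
  rewrite cost_bind; have := cost_jet o v.
  by case: (result (jet L o v)) => [w'|] /=; lia.
set rest := cost (all_nodes _ _).
suff : rest <= (6 * n).+2 * n by lia.
apply: leq_trans (mulle _ (leqnn _)); apply: cost_all_nodes => v _.
by rewrite cost_bind addn0; exact: leq_trans (cost_jet o v) (leqnSn _).
Qed.

End Represented.

End Representation.

(** * Following jets *)

Section Jets.
Context {n : nat} {V : Type} (add : V -> V -> V) (leq : V -> V -> bool).
Local Notation farray := (@farray n).
Local Notation node := 'I_n.
Local Notation result := (result add leq).
Context (D : digraph node) (o : node).
Context (L : adjacency (n := n) (arr := farray)).
Implicit Types (u v w t : node) (marks : farray bool).

Let Dm := swap_arcs D.
Hypothesis wfD : arcs_in_nodes D.
Hypothesis nsev : ~ several_variable D.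
Hypothesis deg_o : 1 < outdeg Dm o.
Hypothesis repL : represents Dm L.

(** A jet has no dead end: every node but [o] is the endnode of a critical arc of [D], which [Dm]
    reverses. *)
Lemma outs_cons u w : arc Dm w u -> u != o ->
  exists v l, outs L u = v :: l /\ arc Dm u v.
Proof.
move=> /wfD/andP[uD _] uo.
have [i [_ /criticalP[_ iu _]]] := critical_source wfD nsev deg_o uD uo.
have : i \in outs L u by rewrite (mem_outs repL).
case lE: (outs L u) => [//|v l] _; exists v, l; split=> //.
by rewrite -(mem_outs repL) lE mem_head.
Qed.

(* [p] lists the nodes of the jet visited so far. *)
Lemma result_follow fuel u marks p :
  path (arc Dm) o p -> uniq (o :: p) -> arc Dm (last o p) u ->
  (forall v, marks v = (v \in p)) -> n <= fuel + size p ->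
  match result (follow fuel L o u marks) with
  | None => exists q, [/\ path (arc Dm) o (rcons q o), uniq (o :: q)
                        & head o q = head u p]
  | Some w => exists s c, [/\ sigma_jet Dm o s c, w \in c
                            & head o (s ++ c) = head u p]
  end.
Proof.
(* [head u p] is the first node of the jet, [u] itself while [p] is empty. The fuel cannot run out:
   [o :: p] would list more than [n] distinct nodes. *)
elim: fuel u marks p => [|fuel IH] u marks p pth uq pu mE fuelP.
  by have := leq_trans (size_uniq_nodes uq) fuelP; rewrite ltnn.
rewrite [result _]/=.
have [uo|uo] := eqVneq u o.
  rewrite [result _]/=; exists p; rewrite rcons_path pth uq uo -uo.
  by split=> //; rewrite uo in pu *.
rewrite [result _]/= mE.
have [up|up] := boolP (u \in p).
  rewrite [result _]/=.
  case/splitPr: up pth uq pu => s c pth uq pu.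
  exists s, (u :: c); rewrite mem_head; split=> //; last by case: (s).
  rewrite /sigma_jet pth uq andbT /=.
  move: pth pu uq; rewrite cat_path last_cat /= => /and3P[_ _ uc] cu.
  case/andP=> _; rewrite cat_uniq /= => /and3P[_ _ ucq].
  by rewrite /elementary_cycle /= rcons_path uc cu.
have [v [l [lE uv]]] := outs_cons pu uo.
rewrite [result _]/= lE [result _]/=.
have := IH v (fun w => if w == u then true else marks w) (rcons p u).
have -> : head v (rcons p u) = head u p by case: (p).
apply.
- by rewrite rcons_path pth.
- by rewrite -rcons_cons rcons_uniq uq inE negb_or uo up.
- by rewrite last_rcons.
- by move=> w; rewrite mem_rcons inE mE; case: eqP.
- by rewrite size_rcons addnS -addSn.
Qed.

Lemma result_jet v : arc Dm o v ->
  match result (jet L o v) with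
  | None => exists q, [/\ path (arc Dm) o (rcons q o), uniq (o :: q)
                        & head o q = v]
  | Some w => exists s c, [/\ sigma_jet Dm o s c, w \in c
                            & head o (s ++ c) = v]
  end.
Proof.
by move=> ov; apply: (@result_follow n v _ [::]); rewrite ?addn0.
Qed.

(** For the induction, [u :: q] is the part of the cycle still unmarked, and [t], where it closes,
    may be marked already. *)
Lemma result_mark_cycle fuel u q t marks :
  path (arc Dm) u q -> arc Dm (last u q) t -> o \notin u :: q ->
  uniq (u :: q) -> {in u :: q, forall v, ~~ marks v} ->
  marks t || (t \in u :: q) -> size q < fuel ->
  forall v, result (mark_cycle fuel L u marks) v = marks v || (v \in u :: q).
Proof.
elim: q u fuel marks => [|w q IH] u [//|fuel] marks pth lt oq uq nm mt szq v.
  rewrite [result _]/=.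
  rewrite (negPf (nm u (mem_head _ _))) [result _]/=.
  have : t \in outs L u by rewrite (mem_outs repL).
  have uo : u != o by rewrite eq_sym; move: oq; rewrite inE.
  case lE: (outs L u) => [//|w l] _.
  have uw : arc Dm u w by rewrite -(mem_outs repL) lE mem_head.
  rewrite (arc_sole wfD nsev deg_o uw lt uo) [result _]/=.
  (* After the last node of the path, the program meets the marked node [t] and changes nothing
     more. *)
  have tE : (if t == u then true else marks t) = true.
    by move: mt; rewrite inE; case: eqP => // _; rewrite orbF.
  set marks' := (X in mark_cycle fuel L t X).
  have -> : result (mark_cycle fuel L t marks') = marks'.
    by case: fuel {szq} => //= fuel; rewrite /marks' tE.
  by rewrite /marks' inE; case: eqP => _; rewrite ?orbT ?orbF.
move: pth => /= /andP[uw pth].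
rewrite [result _]/=.
rewrite (negPf (nm u (mem_head _ _))) [result _]/=.
have : w \in outs L u by rewrite (mem_outs repL).
have [uo oq'] : u != o /\ o \notin w :: q.
  by move: oq; rewrite inE negb_or eq_sym => /andP.
case lE: (outs L u) => [//|w' l] _.
have uw' : arc Dm u w' by rewrite -(mem_outs repL) lE mem_head.
rewrite (arc_sole wfD nsev deg_o uw' uw uo) [result _]/=.
have [uwq uq'] := andP uq.
rewrite (IH w) //.
- by rewrite [in RHS]inE; case: eqP => _; rewrite ?orbT.
- move=> v' v'q; case: eqP => [v'E|_]; first by rewrite -v'E v'q in uwq.
  by apply: nm; rewrite inE v'q orbT.
- by move: mt; rewrite [t \in _]inE; case: eqP.
Qed.

Lemma result_mark_elementary_cycle c w : elementary_cycle Dm c -> w \in c ->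
  o \notin c ->
  forall v, result (mark_cycle n L w (fun=> false)) v = (v \in c).
Proof.
case/and3P=> _ cyc uq /rot_to[k q kE] oc v.
have memE t : (t \in c) = (t \in w :: q) by rewrite -kE mem_rot.
have := cyc; rewrite -(rot_cycle k) kE /= rcons_path => /andP[pth lw].
have uq' : uniq (w :: q) by rewrite -kE rot_uniq.
rewrite (@result_mark_cycle n w q w) ?memE ?mem_head //.
  by rewrite -memE.
by have := size_uniq_nodes uq'.
Qed.

Lemma result_jets_agree_mixed : ~~ result (jets_agree L o) -> mixed_jets Dm o.
Proof.
rewrite /jets_agree result_bind [result (op _)]/=.
have lo v : v \in outs L o -> arc Dm o v by rewrite (mem_outs repL).
have oq c s : sigma_jet Dm o s c -> o \notin c.
  by case/and3P=> _ _ /andP[]; rewrite mem_cat negb_or => /andP[].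
have ocyc q : path (arc Dm) o (rcons q o) -> uniq (o :: q) ->
    o_cycle Dm o (o :: q).
  by move=> pth uq; apply/andP; split; [exact/and3P|exact: mem_head].
case: (outs L o) lo => [//|u l] lo.
rewrite result_bind result_bind.
have := result_jet (lo u (mem_head _ _)).
case: (result (jet L o u)) => [w [s1 [c1 [j1 w1 _]]]|[q [pq uq _]]].
  have [_ e1 _] := and3P j1.
  rewrite result_bind [result (op _)]/= result_bind result_all_nodes.
  move=> /allPn[v vl]; cbv beta; rewrite result_bind.
  have := result_jet (lo v (mem_behead (s := u :: l) vl)).
  case: (result (jet L o v)) => [w' [s2 [c2 [j2 w2 _]]]|[q [pq uq _]]].
    rewrite [result _]/=.
    rewrite (result_mark_elementary_cycle e1 w1 (oq _ _ j1)) => w'1.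
    right; exists s1, c1, s2, c2; split=> // -[k c2E].
    by rewrite c2E mem_rot (negPf w'1) in w2.
  by move=> _; left; exists (o :: q), s1, c1; split=> //; exact: ocyc.
rewrite result_all_nodes => /allPn[v vl]; cbv beta; rewrite result_bind.
have := result_jet (lo v (mem_behead (s := u :: l) vl)).
case: (result (jet L o v)) => [w' [s2 [c2 [j2 w2 _]]]|//] _.
by left; exists (o :: q), s2, c2; split=> //; exact: ocyc.
Qed.

(** Each jet ends on the side of [Z] on which it starts, and an [o]-cycle starts outside [Z]; jets
    starting on different sides cannot share their cycle. *)
Lemma separating_result_jets_agree Z : separating D o Z ->
  ~~ result (jets_agree L o).
Proof.
case=> _ oZ side [u1 u1Z ou1] [u2 u2Z ou2].
rewrite /jets_agree result_bind [result (op _)]/=.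
have lo v : (v \in outs L o) = arc Dm o v by rewrite (mem_outs repL).
have oq c s : sigma_jet Dm o s c -> o \notin c.
  by case/and3P=> _ _ /andP[]; rewrite mem_cat negb_or => /andP[].
have jetP v : arc Dm o v -> match result (jet L o v) with
    | None => v \notin Z
    | Some w => (w \in Z) = (v \in Z) /\
        exists2 c, elementary_cycle Dm c /\ o \notin c &
          w \in c /\ {in c, forall t, (t \in Z) = (v \in Z)}
    end.
  move=> /result_jet; case: (result _) => [w [s [c [jc wc <-]]]|[q [pq uq <-]]].
    have jetside t : t \in c -> (t \in Z) = (head o (s ++ c) \in Z).
      by move=> tc; rewrite (sigma_jet_side side jc) // mem_cat tc orbT.
    split; first exact: jetside.
    by exists c; [split; [case/and3P: jc|exact: oq jc]|].
  exact: (o_cycle_side oZ side).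
have : u1 \in outs L o by rewrite lo.
have : u2 \in outs L o by rewrite lo.
case: (outs L o) lo => [//|u l] lo u2l u1l.
have ou : arc Dm o u by rewrite -lo mem_head.
(* Whichever side the first listed node [u] is on, one of [u1] and [u2] is on the other side, hence
   further down the list. *)
have [v vl vu] : exists2 v, v \in l & (v \in Z) != (u \in Z).
  have [uZ|uZ] := boolP (u \in Z).
    exists u2; last by rewrite (negPf u2Z).
    by move: u2l; rewrite inE; case: eqP => // uE; rewrite uE uZ in u2Z.
  exists u1; last by rewrite u1Z.
  by move: u1l; rewrite inE; case: eqP => // uE; rewrite -uE u1Z in uZ.
have ov : arc Dm o v by rewrite -lo inE vl orbT.
rewrite result_bind result_bind.
have := jetP u ou; have := jetP v ov.
case: (result (jet L o u)) => [w|] jv.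
  move=> [_ [c [ec oc] [wc cside]]].
  rewrite result_bind [result (op _)]/= result_bind result_all_nodes.
  apply/allPn; exists v => //; cbv beta; rewrite result_bind.
  case: (result (jet L o v)) jv => [w' [w'v _]|//].
  rewrite [result _]/= (result_mark_elementary_cycle ec wc oc).
  by apply: contra vu => /cside <-; rewrite w'v.
move=> uZ; rewrite result_all_nodes; apply/allPn; exists v => //; cbv beta.
rewrite result_bind; case: (result (jet L o v)) jv => [//|vZ].
by rewrite (negPf uZ) (negPf vZ) in vu.
Qed.

End Jets.

(** * Construction of the tangent digraph *)

Section TangentConstruction.
Context {R : realType} {n : nat} (A : 'M[\bar R]_n) (x : 'cV[\bar R]_n).
Local Open Scope ereal_scope.
Local Notation farray := (@farray n).
Local Notation prog := (prog n (\bar R) farray).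
Local Notation node := 'I_n.
Local Notation result := 
  (@result n (\bar R) (fun a b => a + b) (fun a b => a <= b)).
Local Notation cost := 
  (@cost n (\bar R) (fun a b => a + b) (fun a b => a <= b)).
Local Notation adjacency := (adjacency (n := n) (arr := farray)).
Implicit Types (i j u v : node) (L : adjacency).

Let vec : farray (\bar R) := fun j => x j ord0.
Let rows : farray (farray (\bar R)) := fun i j => A i j.
Let D := tangent_digraph A x.

Lemma result_equal (a b : \bar R) : result (equal a b) = (a == b).
Proof. by rewrite /= eq_le; case: (a <= b). Qed.

Lemma cost_equal (a b : \bar R) : (cost (equal a b) <= 2)%N.
Proof. by rewrite /=; case: (a <= b). Qed.

Lemma result_row_max i :
  result (row_max -oo (rows i) vec) = mp_mulmx A x i ord0.
Proof.
rewrite /row_max result_fold_nodes mxE -big_enum.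
rewrite -(big_map (fun j => A i j + x j ord0) xpredT id) -foldl_idx /=.
elim: (enum _) -oo => [//|j l IH] m /=; rewrite IH; congr foldl.
by rewrite /vec /rows /maxe; case: ltgtP.
Qed.

Lemma cost_row_max i : (cost (row_max -oo (rows i) vec) <= 5 * n)%N.
Proof.
by rewrite -[X in (_ <= _ * X)%N]card_ord cardE; exact: cost_fold_nodes.
Qed.

(** The arc has to be new, since [add_arc] extends the lists without testing for repetitions. *)
Lemma result_add_arc D' L j i : represents D' L -> ~~ arc D' j i ->
  represents
    (Digraph (nodes D') (fun u v => arc D' u v || (u == j) && (v == i)))
    (result (add_arc L j i)).
Proof.
move=> [nL oL iL] ji; split=> // [u|v] /=.
  have [uq uE] := oL u; case: (eqVneq u j) => [uj|_]; last first.
    by split=> // v; rewrite orbF.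
  rewrite -uj in ji *; split=> [|v]; first by rewrite /= uq uE ji.
  by rewrite inE uE orbC.
have [uq uE] := iL v; case: (eqVneq v i) => [vi|_]; last first.
  by split=> // u; rewrite andbF orbF.
rewrite -vi in ji *; split=> [|u]; first by rewrite /= uq uE ji.
by rewrite inE uE andbT orbC.
Qed.

Lemma result_add_arcs (b : pred node) (f : adjacency -> node -> prog adjacency)
    i D' L (l : seq node) :
  (forall L' j,
     result (f L' j) = if b j then result (add_arc L' j i) else L') ->
  uniq l -> represents D' L -> {in l, forall j, ~~ arc D' j i} ->
  represents
    (Digraph (nodes D') (fun u v => arc D' u v || [&& v == i, u \in l & b u]))
    (result (fold_nodes f L l)).
Proof.
move=> fE; rewrite result_fold_nodes.
elim: l D' L => [|j l IH] D' L /= uq repL narc.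
  by move: repL => [nL oL iL]; split=> // u; [have [uq' uE] := oL u
    |have [uq' uE] := iL u]; split=> // v; rewrite uE /= andbF orbF.
have [jl uql] := andP uq; rewrite fE.
have narc' : {in l, forall k, ~~ arc D' k i}.
  by move=> k kl; apply: narc; rewrite inE kl orbT.
have keyE u v : (b j && (u == j) && (v == i)) || [&& v == i, u \in l & b u] =
    [&& v == i, u \in j :: l & b u].
  rewrite inE; case: (v == i); rewrite ?andbF //= andbT.
  by case: eqVneq => [->|_]; rewrite ?andbF ?andbT //= (negPf jl) orbF.
case: (b j) keyE => /= keyE.
  have := IH _ _ uql (result_add_arc repL (narc j (mem_head _ _))).
  case=> [k kl|nL oL iL].
    by rewrite /= negb_or narc' // eqxx andbT; apply: contraNneq jl => <-.
  by split=> // u; [have [uq' uE] := oL u|have [uq' uE] := iL u]; split=> // v;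
    rewrite uE /= -orbA keyE.
have [nL oL iL] := IH _ _ uql repL narc'.
by split=> // u; [have [uq' uE] := oL u|have [uq' uE] := iL u]; split=> // v;
  rewrite uE /= keyE.
Qed.

Lemma represents_eq D1 D2 L : nodes D1 = nodes D2 -> arc D1 =2 arc D2 ->
  represents D1 L -> represents D2 L.
Proof.
move=> nE aE [[uq nL] oL iL]; split.
- by split=> // u; rewrite nL nE.
- by move=> u; have [uq' uE] := oL u; split=> // v; rewrite uE aE.
- by move=> u; have [uq' uE] := iL u; split=> // v; rewrite uE aE.
Qed.

Lemma represents_add_node D' L i : i \notin nodes D' -> represents D' L ->
  represents (Digraph (i |: nodes D') (arc D')) (add_node L i).
Proof.
move=> iD [[uq nL] oL iL]; split=> //; split; first by rewrite /= nL iD uq.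
by move=> v; rewrite !inE nL.
Qed.

(** The loop invariant of [build_tangent] once the rows in [W] are processed. Arcs into [W] may
    start at nodes not yet added. *)
Let part (W : {set node}) : digraph node :=
  Digraph (supp x :&: W) (fun u v => (v \in W) && arc D u v).

Lemma result_build_tangent : mp_vector x ->
  represents D (result (build_tangent -oo rows vec)).
Proof.
move=> mx; rewrite /build_tangent result_bind [result (op _)]/=.
rewrite result_bind [result (op _)]/= result_fold_nodes.
set step := (X in foldl X); set L0 := Adjacency _ _ _.
have arcDE u v : arc D u v = [&& v \in supp x,
    A v u + x u ord0 == mp_mulmx A x v ord0 & mp_mulmx A x v ord0 == x v ord0].
  by rewrite /= [u \in _]in_set.
have stepP (W : {set node}) L i : i \notin W -> represents (part W) L ->
    represents (part (i |: W)) (step L i).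
  move=> iW repL; rewrite /step result_bind [result (op _)]/=.
  rewrite result_bind [result (op _)]/= leeNy_eq.
  have iS : (i \in supp x) = (vec i != -oo) by exact: supp_eqNy.
  case: eqP iS => xi iS.
    apply: represents_eq repL => [|u v].
      apply/setP=> v; rewrite !in_setI in_setU1.
      by case: (eqVneq v i) => [->|//]; rewrite iS.
    rewrite [LHS]/((v \in W) && arc D u v) [RHS]/((v \in i |: W) && arc D u v).
    rewrite in_setU1 arcDE.
    by case: (eqVneq v i) => [->|//]; rewrite iS; case: (i \in W).
  have iP : i \notin nodes (part W) by rewrite in_setI (negPf iW) andbF.
  have nE : i |: nodes (part W) = supp x :&: (i |: W).
    apply/setP=> v; rewrite in_setU1 !in_setI in_setU1.
    by case: (eqVneq v i) => [->|//]; rewrite iS.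
  have repL' := represents_add_node iP repL.
  have aE u v : arc (part (i |: W)) u v =
      arc (part W) u v || (v == i) && arc D u i.
    rewrite [LHS]/((v \in i |: W) && arc D u v).
    rewrite [arc (part W) u v]/((v \in W) && arc D u v) in_setU1.
    by case: (eqVneq v i) => [->|_]; case: (_ \in W); case: (arc D _ _).
  rewrite result_bind [result (op _)]/= result_bind result_row_max.
  rewrite result_bind result_equal; case: eqP => xE; last first.
    apply: represents_eq repL' => // u v; rewrite aE arcDE.
    by move/eqP/negPf: xE => ->; rewrite !andbF orbF.
  apply: represents_eq (@result_add_arcs
    (fun j => A i j + x j ord0 == mp_mulmx A x i ord0) _ i _ _ (enum 'I_n)
    _ _ repL' _) => //.
  - move=> u v; rewrite aE arcDE iS xE eqxx andbT.
    by rewrite [LHS]/(arc (part W) u v || [&& v == i, u \in enum 'I_n & _])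
      mem_enum.
  - by move=> L' j; rewrite result_bind result_bind result_equal; case: ifP.
  - exact: enum_uniq.
  - by move=> j _; rewrite /= (negPf iW).
suff foldP s (W : {set node}) L : uniq s -> {in s, forall i, i \notin W} ->
    represents (part W) L ->
    represents (part (W :|: [set i in s])) (foldl step L s).
  have setE : set0 :|: [set i in enum 'I_n] = setT.
    by apply/setP=> i; rewrite !inE mem_enum.
  apply: represents_eq (foldP (enum 'I_n) set0 L0 (enum_uniq _) _ _)
    => [|u v||].
  - by rewrite setE [LHS]setIT.
  - rewrite [LHS]/((v \in _) && arc D u v).
    by rewrite setE in_setT.
  - by move=> i _; rewrite in_set0.
  - split=> // [|u|u]; split=> // v; rewrite ?in_setI ?in_set0 ?andbF //.
    by rewrite [RHS]/((v \in set0) && arc D u v) in_set0.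
    by rewrite [RHS]/((u \in set0) && arc D v u) in_set0.
elim: s W L => [|i s IH] W L uq sW repL.
  have -> : W :|: [set i in [::]] = W by apply/setP=> i; rewrite !inE orbF.
  exact: repL.
have [si uqs] := andP uq.
have -> : W :|: [set j in i :: s] = (i |: W) :|: [set j in s].
  by apply/setP=> j; rewrite !inE orbCA orbA.
apply: IH => // [j js|]; last exact: stepP (sW i (mem_head _ _)) repL.
rewrite in_setU1 negb_or sW ?inE ?js ?orbT // andbT.
by apply: contraNneq si => <-.
Qed.

(** Two arrays are filled. A row costs [5 * n] for its maximum, [10 * n] for its arcs (visit,
    [term], [equal], [add_arc]: 1 + 3 + 2 + 4) and six single operations. *)
Lemma cost_build_tangent :
  (cost (build_tangent -oo rows vec) <= 2 * n + (15 * n + 6) * n)%N.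
Proof.
rewrite /build_tangent cost_bind [cost (op _)]/= cost_bind [cost (op _)]/=.
rewrite addn0 addnA addnn -mul2n leq_add2l.
rewrite addnS -[X in (_ <= _ * X)%N]card_ord cardE.
apply: cost_fold_nodes => L i.
rewrite cost_bind [cost (op _)]/= cost_bind [cost (op _)]/=.
case: (result (op _)); first by rewrite /=; lia.
rewrite cost_bind [cost (op _)]/= cost_bind cost_bind.
have := cost_row_max i; rewrite [result (op (Get rows i))]/=.
set m := Defs.result _ _ _; set c := Defs.cost _ _ (row_max _ _ _) => cn.
have := cost_equal m (vec i); rewrite [result (op (Get vec i))]/=.
set c' := Defs.cost _ _ (equal _ _) => c'n.
case: (result (equal _ _)); last by rewrite [Defs.cost _ _ (Ret _)]/=; lia.
set c'' := Defs.cost _ _ (fold_nodes _ _ _).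
suff : (c'' <= 10 * n)%N by lia.
rewrite -[X in (_ <= _ * X)%N]card_ord cardE.
apply: cost_fold_nodes => L' j; rewrite cost_bind cost_bind.
have := cost_equal (result (term (rows i) vec j)) m.
set d := Defs.cost _ _ (equal _ _) => dn.
by case: (result (equal _ _)) => /=; lia.
Qed.

End TangentConstruction.

(** * Correctness and cost of the algorithm *)

Section Correctness.
Context {R : realType} {n : nat} (A : 'M[\bar R]_n) (x : 'cV[\bar R]_n).
Hypothesis Xx : scrX A x.
Local Notation eadd := (fun a b : \bar R => (a + b)%E).
Local Notation ele := (fun a b : \bar R => (a <= b)%E).
Let D := tangent_digraph A x.
Let wfD : arcs_in_nodes D := @tangent_arcs_in_nodes _ _ A x.

Lemma algorithm_result_correct :
  returns A x (algorithm_result A x) /\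
  (algorithm_result A x = true <-> union_irreducible D).
Proof.
have [mx _ _] := Xx; have repL := result_build_tangent A mx.
rewrite /algorithm_result /algorithm /check_extremal result_bind.
set L := result _ _ (build_tangent _ _ _) in repL *.
rewrite result_bind; case: (result_several_variable _ _ repL) => [sev|nsev].
  split; first exact: Step2_false.
  by split=> // /(several_variable_reducible wfD sev).
have repLm := represents_reversed repL.
have := result_find_branching eadd ele repLm.
rewrite [node_list (reversed L)]/=; cbv zeta; rewrite result_bind.
case: (result _ _ (find_node _ _)) => [o [oD deg_o]|deg1].
  rewrite result_bind.
  case: (boolP (result _ _ (jets_agree _ _))) => [agree|disagree]; last first.
    have mixed := result_jets_agree_mixed wfD nsev deg_o repLm disagree.
    have [Z sepZ] := mixed_jets_separating wfD nsev deg_o mixed.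
    split; first exact: Step4_false oD deg_o mixed.
    by split=> // /(separating_reducible wfD sepZ).
  have nsep Z : ~ separating D o Z.
    move=> /(separating_result_jets_agree eadd ele wfD nsev deg_o repLm).
    by rewrite agree.
  have nmixed : ~ mixed_jets (swap_arcs D) o.
    by case/(mixed_jets_separating wfD nsev deg_o) => Z /nsep.
  have wfDm : arcs_in_nodes (swap_arcs D) by move=> j i /wfD; rewrite andbC.
  have restP := result_rest_empty eadd ele repLm wfDm oD.
  case: (boolP (result _ _ (rest_empty _ _))) restP => /= _ restP.
    have nrest := elimF restP erefl.
    split; first exact: Step5_true oD deg_o nmixed nrest.
    by split=> // _; exact: (unseparated_irreducible wfD nsev deg_o oD nrest).
  have rest := elimT restP erefl.
  split; first exact: Step5_false oD deg_o nmixed rest.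
  by split=> // /(rest_nonempty_reducible wfD oD rest).
(* Outdegrees in [swap_arcs D] are indegrees in [D], so the failed search is the condition of step
   3. *)
have ind1 i : i \in nodes D -> indeg D i <= 1 by exact: deg1.
have isoP := result_no_isolated_subset eadd ele repL wfD (supp_neq0 Xx).
case: (boolP (result _ _ (no_isolated_subset _))) isoP => /= _ isoP.
  have niso W : W != set0 -> W \proper nodes D -> ~ isolated D W.
    by move=> W0 WD isoW; apply: (elimF isoP erefl); exists W.
  split; first exact: Step3_true.
  by split=> // _; exact: unisolated_irreducible.
have [W [W0 WD isoW]] := elimT isoP erefl.
split; first exact: Step3_false isoW.
by split=> // /(isolated_reducible wfD W0 WD isoW).
Qed.

(** On the longest branch the bounds add up to [32 * n ^ 2 + 40 * n + 5], at most [77 * n ^ 2] for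
    positive [n]; 100 is a round value. Positivity of [n] holds because the support is nonempty. *)
Lemma operations_le : operations A x <= 100 * n ^ 2.
Proof.
have [mx _ _] := Xx; have repL := result_build_tangent A mx.
have n0 : 0 < n.
  by have [i _] := set0Pn _ (supp_neq0 Xx); exact: leq_ltn_trans (ltn_ord i).
rewrite /operations /algorithm /check_extremal cost_bind.
have := cost_build_tangent A x.
set L := result _ _ (build_tangent _ _ _) in repL *.
set c0 := cost _ _ _ => cost0.
rewrite cost_bind.
have := cost_several_variable eadd ele repL.
set c1 := cost _ _ (several_nodes _ _ _) => cost1.
case: (result _ _ _); first by rewrite /=; nia.
have repLm := represents_reversed repL.
rewrite cost_bind.
have := cost_find_branching eadd ele repLm.
set c2 := cost _ _ (find_node _ _) => cost2.
case: (result _ _ _) => [o|]; last first.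
  have := cost_no_isolated_subset eadd ele repL.
  by set c3 := cost _ _ _; nia.
rewrite cost_bind.
have := cost_jets_agree eadd ele repLm o.
set c3 := cost _ _ (jets_agree _ _) => cost3.
case: (result _ _ _); last by rewrite /=; nia.
have := cost_rest_empty eadd ele repLm o.
by set c4 := cost _ _ _; nia.
Qed.

End Correctness.

Theorem theorem4p1 :
  exists C : nat,
  forall (R : realType) (n : nat) (A : 'M[\bar R]_n) (x : 'cV[\bar R]_n),
    mp_matrix A -> scrX A x ->
    [/\ returns A x (algorithm_result A x),
        algorithm_result A x = true <-> extremal (scrX' A) x
      & (operations A x <= C * n ^ 2)%N].
Proof.
exists 100 => R n A x mA Xx.
have [ret cor] := algorithm_result_correct Xx.
split=> //; last exact: operations_le.
by rewrite cor; split=> /(extremal_union_irreducible mA Xx).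
Qed.
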